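(* Let $K$ be a non-Archimedean real closed field which admits an integer part whose non-negative cone is a model of Peano Arithmetic. Then $K$ admits left exponentiation, and the value group $G=v(K^\times)$ of $K$ (with respect to the natural valuation $v$) is an exponential group in the additive ordered group $(\overline{K},+,0,<)$ of the residue field $\overline{K}$ of $K$.
   Context: Integer part: an integer part of an ordered field $R$ is a discretely ordered subring $Z\subseteq R$ such that for every $r\in R$ there is $z\in Z$ with $z\le r<z+1$. Its non-negative cone is $Z^{\ge 0}$, regarded as a structure in the language $\{+,\cdot,0,1,<\}$. Peano Arithmetic (PA) is the theory of non-negative cones of discretely ordered commutative rings with $1$ together with the induction axiom for every first-order formula of $\{+,\cdot,0,1,<\}$. Natural valuation on a divisible ordered abelian group $(G,+,0,<)$: for non-zero $x,y\in G$ put $x\sim y$ if there is $n\in\mathbb{N}$ with $n|x|\ge|y|$ and $n|y|\ge|x|$, and write $x\ll y$ if $n|x|<|y|$ for all $n\in\mathbb{N}$. Let $[x]$ be the $\sim$-class of $x$ and $\Gamma=\{[x]:x\in G\setminus\{0\}\}$, totally ordered by $[y]<[x]$ iff $x\ll y$. $\Gamma$ is called the rank of $G$, and $v(x)=[x]$ for $x\ne0$, $v(0)=\infty$, is the natural valuation. For $\gamma\in\Gamma$, the Archimedean component $B_\gamma$ is a maximal Archimedean subgroup of $G$ containing some chosen $x\in\gamma$ (up to isomorphism of ordered groups, $\{x: v(x)\ge\gamma\}/\{x:v(x)>\gamma\}$). Natural valuation on a real closed field $K$: the natural valuation $v$ of the ordered group $(K,+,0,<)$. The value set $v(K^\times)$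 with addition $v(x)+v(y)=v(xy)$ is a divisible ordered abelian group, called the value group. Put $R_v=\{a\in K:v(a)\ge0\}$, $\mu_v=\{a\in K:v(a)>0\}$, $\mathcal{U}_v^{>0}=\{a\in K^{>0}:v(a)=0\}$, and $\overline{K}=R_v/\mu_v$ (the residue field, an Archimedean ordered field). Left exponentiation: the ordered groups $(K,+,0,<)$ and $(K^{>0},\cdot,1,<)$ are divisible, i.e. ordered $\mathbb{Q}$-vector spaces. $K$ admits left exponentiation if there is an order preserving group isomorphism from some ($\mathbb{Q}$-vector space) complement $A$ of $R_v$ in $(K,+,0,<)$ onto some ($\mathbb{Q}$-vector space) complement $B$ of $\mathcal{U}_v^{>0}$ in $(K^{>0},\cdot,1,<)$. Exponential group: an ordered abelian group $G$ with rank $\Gamma$ and Archimedean components $\{B_\gamma:\gamma\in\Gamma\}$ is an exponential group in an Archimedean ordered group $C$ if $\Gamma$ is isomorphic as a linear order to the negative cone $G^{<0}$ and each $B_\gamma$ is isomorphic to $C$ as an ordered group. *)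

(* Defs.v *)
From HB Require Import structures.
From mathcomp Require Import all_boot all_order all_algebra.
From mathcomp Require Import boolp.

Set Implicit Arguments.
Unset Strict Implicit.
Unset Printing Implicit Defensive.

Import Order.TTheory GRing.Theory Num.Theory.
Local Open Scope ring_scope.
Local Open Scope quotient_scope.

(** * First-order arithmetic *)

Record arith_structure := ArithStructure {
  arith_sort :> Type;
  arith_zero : arith_sort;
  arith_one : arith_sort;
  arith_add : arith_sort -> arith_sort -> arith_sort;
  arith_mul : arith_sort -> arith_sort -> arith_sort;
  arith_lt : arith_sort -> arith_sort -> Prop
}.

(* Variables are de Bruijn indices. *)
Inductive arith_term :=
  | TVar of nat
  | TZero
  | TOne
  | TAdd of arith_term & arith_term
  | TMul of arith_term & arith_term.

Inductive arith_formula :=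
  | FEq of arith_term & arith_term
  | FLt of arith_term & arith_term
  | FNot of arith_formula
  | FAnd of arith_formula & arith_formula
  | FOr of arith_formula & arith_formula
  | FImply of arith_formula & arith_formula
  | FForall of arith_formula
  | FExists of arith_formula.

Definition env_cons (M : Type) (x : M) (e : nat -> M) (i : nat) : M :=
  if i is j.+1 then e j else x.

Section Satisfaction.
Variable M : arith_structure.

Fixpoint eval_term (e : nat -> M) (t : arith_term) : M :=
  match t with
  | TVar i => e i
  | TZero => arith_zero M
  | TOne => arith_one M
  | TAdd t1 t2 => arith_add (eval_term e t1) (eval_term e t2)
  | TMul t1 t2 => arith_mul (eval_term e t1) (eval_term e t2)
  end.

Fixpoint sat (e : nat -> M) (f : arith_formula) : Prop :=
  match f with
  | FEq t1 t2 => eval_term e t1 = eval_term e t2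
  | FLt t1 t2 => arith_lt (eval_term e t1) (eval_term e t2)
  | FNot f1 => ~ sat e f1
  | FAnd f1 f2 => sat e f1 /\ sat e f2
  | FOr f1 f2 => sat e f1 \/ sat e f2
  | FImply f1 f2 => sat e f1 -> sat e f2
  | FForall f1 => forall x : M, sat (env_cons x e) f1
  | FExists f1 => exists x : M, sat (env_cons x e) f1
  end.

(* Truth of the universal closure of f. *)
Definition models (f : arith_formula) : Prop := forall e : nat -> M, sat e f.

(* Truth of the induction axiom for f, where the induction variable is the
   de Bruijn index 0 and the other free variables, interpreted by e, are
   parameters. *)
Definition models_induction (f : arith_formula) : Prop :=
  forall e : nat -> M,
    sat (env_cons (arith_zero M) e) f ->
    (forall x : M, sat (env_cons x e) f ->
       sat (env_cons (arith_add x (arith_one M)) e) f) ->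
    forall x : M, sat (env_cons x e) f.

End Satisfaction.

(** * Discretely ordered rings, non-negative cones, Peano Arithmetic *)

Definition discretely_ordered (D : realDomainType) (Z : {pred D}) : Prop :=
  forall z : D, z \in Z -> ~ (0 < z < 1).

Section NonNegativeCone.
Variables (D : realDomainType) (Z : subringClosed D).

Definition nneg_sort : Type := {x : D | (x \in Z) && (0 <= x)}.

Lemma nneg_zero_subproof : ((0 : D) \in Z) && ((0 : D) <= 0).
Proof. by rewrite rpred0 lexx. Qed.

Lemma nneg_one_subproof : ((1 : D) \in Z) && (0 <= (1 : D)).
Proof. by rewrite rpred1 ler01. Qed.

Lemma nneg_add_subproof (x y : nneg_sort) :
  (sval x + sval y \in Z) && (0 <= sval x + sval y).
Proof.
case: x y => [x /andP[xZ x0]] [y /andP[yZ y0]] /=.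
by rewrite rpredD // addr_ge0.
Qed.

Lemma nneg_mul_subproof (x y : nneg_sort) :
  (sval x * sval y \in Z) && (0 <= sval x * sval y).
Proof.
case: x y => [x /andP[xZ x0]] [y /andP[yZ y0]] /=.
by rewrite rpredM // mulr_ge0.
Qed.

Definition nneg_cone : arith_structure := {|
  arith_sort := nneg_sort;
  arith_zero := exist _ 0 nneg_zero_subproof;
  arith_one := exist _ 1 nneg_one_subproof;
  arith_add := fun x y => exist _ (sval x + sval y) (nneg_add_subproof x y);
  arith_mul := fun x y => exist _ (sval x * sval y) (nneg_mul_subproof x y);
  arith_lt := fun x y => sval x < sval y
|}.

End NonNegativeCone.

(* The theory of non-negative cones of discretely ordered commutative rings.
   A totally ordered commutative ring whose positive elements are closed under
   products has no zero divisors, so it is a realDomainType; it is covered by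
   taking for Z the whole of D. *)
Definition PAminus_theorem (f : arith_formula) : Prop :=
  forall (D : realDomainType) (Z : subringClosed D),
    discretely_ordered Z -> models (nneg_cone Z) f.

Definition models_PA (M : arith_structure) : Prop :=
  (forall f : arith_formula, PAminus_theorem f -> models M f) /\
  (forall f : arith_formula, models_induction M f).

Definition integer_part (K : realDomainType) (Z : {pred K}) : Prop :=
  discretely_ordered Z /\
  forall r : K, exists2 z : K, z \in Z & z <= r < z + 1.

(** * Ordered abelian groups *)

(* Totality is a field of the mixin, instead of being inherited from
   Order.Total, because the join with Order.Total would have to be declared
   before Num.RealDomain. *)
HB.mixin Record POrderedZmodule_isOrdered G of Num.POrderedZmodule G := {
  oz_le_total : total (<=%R : rel G);
  oz_leD2l : forall z x y : G, x <= y -> z + x <= z + y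
}.

#[short(type="orderedZmodType")]
HB.structure Definition OrderedZmodule :=
  { G of Num.POrderedZmodule G & POrderedZmodule_isOrdered G }.

(* v is q times u in a torsion-free divisible group, viewed as a vector space
   over the rationals. *)
Definition is_qscale (V : zmodType) (q : rat) (u v : V) : Prop :=
  v *~ denq q = u *~ numq q.

Definition qsubspace (V : zmodType) (A : {pred V}) : Prop :=
  zmod_closed A /\
  forall (q : rat) (u v : V), u \in A -> is_qscale q u v -> v \in A.

Definition qcomplement (V : zmodType) (A H : {pred V}) : Prop :=
  [/\ qsubspace A,
      forall x : V, x \in A -> x \in H -> x = 0
    & forall x : V, exists2 a : V, a \in A & exists2 h : V, h \in H & x = a + h].

Definition ordered_isog (V W : orderedZmodType) (A : {pred V}) (B : {pred W})
    : Prop :=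
  exists f : V -> W,
    [/\ forall x : V, x \in A -> f x \in B,
        {in A &, {morph f : x y / x + y}},
        {in A &, {mono f : x y / x <= y}}
      & forall y : W, y \in B -> exists2 x : V, x \in A & f x = y].

Section NaturalValuation.
Variable G : orderedZmodType.
Implicit Types x y z : G.

Definition oabs x : G := Num.max x (- x).

Definition arch_equiv x y : bool :=
  `[< exists n : nat, oabs y <= oabs x *+ n /\ oabs x <= oabs y *+ n >].

Definition arch_lt x y : bool := `[< forall n : nat, oabs x *+ n < oabs y >].

Lemma oz_comparable x y : x >=< y.
Proof. exact: oz_le_total. Qed.

Lemma oz_leNgt x y : (x <= y) = ~~ (y < x).
Proof. by rewrite comparable_leNgt ?oz_comparable. Qed.

Lemma oz_ltNge x y : (x < y) = ~~ (y <= x).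
Proof. by rewrite comparable_ltNge ?oz_comparable. Qed.

Lemma oz_leD x y z t : x <= y -> z <= t -> x + z <= y + t.
Proof.
move=> xy zt; apply: (@le_trans _ _ (x + t)); first exact: oz_leD2l.
by rewrite ![_ + t]addrC; apply: oz_leD2l.
Qed.

Lemma oz_ltD2l z x y : x < y -> z + x < z + y.
Proof.
rewrite !lt_neqAle => /andP[xy /(oz_leD2l z) ->]; rewrite andbT.
by apply: contra_neq xy => /addrI.
Qed.

Lemma oz_leMn n x y : x <= y -> x *+ n <= y *+ n.
Proof. by move=> xy; elim: n => // n IHn; rewrite !mulrS oz_leD. Qed.

Lemma oabs_ge0 x : 0 <= oabs x.
Proof.
rewrite /oabs comparable_le_max ?oz_comparable //.
have /orP[-> //|] := oz_le_total 0 x; move=> /(oz_leD2l (- x)).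
by rewrite addr0 addNr => ->; rewrite orbT.
Qed.

Lemma oabs_eq0 x : (oabs x == 0) = (x == 0).
Proof.
by rewrite /oabs maxElt; case: ifP => _ //; rewrite oppr_eq0.
Qed.

Lemma oz_leMnl m n x : 0 <= x -> (m <= n)%N -> x *+ m <= x *+ n.
Proof.
move=> x0 mn; rewrite -(subnKC mn) mulrnDr -[leLHS]addr0 oz_leD //.
by rewrite -(mul0rn _ (n - m)) oz_leMn.
Qed.

Lemma arch_equiv_refl : reflexive arch_equiv.
Proof. by move=> x; apply/asboolP; exists 1%N; rewrite mulr1n. Qed.

Lemma arch_equiv_sym : symmetric arch_equiv.
Proof.
by move=> x y; apply/asboolP/asboolP => -[n [h1 h2]]; exists n.
Qed.

Lemma arch_equiv_trans : transitive arch_equiv.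
Proof.
move=> y x z /asboolP[n [xy yx]] /asboolP[m [yz zy]].
apply/asboolP; exists (n * m)%N; split.
  by apply: le_trans yz _; rewrite mulrnA oz_leMn.
by apply: le_trans yx _; rewrite mulnC mulrnA oz_leMn.
Qed.

Lemma arch_ltNge x y :
  ~~ arch_lt x y -> exists n : nat, oabs y <= oabs x *+ n.
Proof.
by move=> /asboolPn/existsNP[n /negP]; rewrite -oz_leNgt => h; exists n.
Qed.

Lemma arch_lt_irr x : ~~ arch_lt x x.
Proof. by apply/asboolPn => /(_ 1%N); rewrite mulr1n ltxx. Qed.

Lemma arch_lt_trans : transitive arch_lt.
Proof.
move=> y x z /asboolP xy /asboolP yz; apply/asboolP => n.
by apply: lt_trans (xy n) _; have := yz 1%N; rewrite mulr1n.
Qed.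

Lemma arch_lt_equivl x x' y : arch_equiv x x' -> arch_lt x y -> arch_lt x' y.
Proof.
move=> /asboolP[k [h _]] /asboolP xy; apply/asboolP => n.
by apply: le_lt_trans (xy (k * n)%N); rewrite mulrnA oz_leMn.
Qed.

Lemma arch_lt_equivr x y y' : arch_equiv y y' -> arch_lt x y -> arch_lt x y'.
Proof.
move=> /asboolP[k [_ h]] /asboolP xy; apply/asboolP => n.
rewrite oz_ltNge; apply/negP => /(oz_leMn k) h'.
by have := xy (n * k)%N; rewrite oz_ltNge mulrnA (le_trans h h').
Qed.

Lemma arch_lt_total x y : [|| arch_lt x y, arch_equiv x y | arch_lt y x].
Proof.
case xy: (arch_lt x y) => //=; case yx: (arch_lt y x); first by rewrite orbT.
rewrite orbF; have [n hn] := arch_ltNge (negbT xy).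
have [m hm] := arch_ltNge (negbT yx).
apply/asboolP; exists (maxn n m); split.
  by apply: le_trans hn _; rewrite oz_leMnl ?oabs_ge0 // leq_maxl.
by apply: le_trans hm _; rewrite oz_leMnl ?oabs_ge0 // leq_maxr.
Qed.

Definition nonzero : Type := {x : G | x != 0}.
HB.instance Definition _ := Choice.on nonzero.
HB.instance Definition _ := SubType.on nonzero.

Definition nonzero_equiv (x y : nonzero) : bool := arch_equiv (val x) (val y).

Lemma nonzero_equiv_class : equiv_class_of nonzero_equiv.
Proof.
split=> [x|x y|y x z]; first exact: arch_equiv_refl.
  exact: arch_equiv_sym.
exact: arch_equiv_trans.
Qed.

Canonical nonzero_equiv_rel := EquivRelPack nonzero_equiv_class.
Canonical nonzero_encModRel := defaultEncModRel nonzero_equiv.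

Definition rank : Type := {eq_quot nonzero_equiv}.
HB.instance Definition _ := EqQuotient.on rank.
HB.instance Definition _ := Choice.on rank.

Definition arch_class (x : nonzero) : rank := \pi_rank x.

Lemma arch_class_eq (x y : nonzero) :
  (arch_class x == arch_class y) = arch_equiv (val x) (val y).
Proof. by rewrite /arch_class piE. Qed.

Lemma arch_class_repr (c : rank) : arch_class (repr c) = c.
Proof. exact: reprK. Qed.

(* Larger Archimedean classes are smaller in the rank; see rank_ltE. *)
Definition rank_lt (c d : rank) : bool :=
  arch_lt (val (repr d)) (val (repr c)).
Definition rank_le (c d : rank) : bool := (c == d) || rank_lt c d.

Lemma rank_lt_def c d : rank_lt c d = (d != c) && rank_le c d.
Proof.
rewrite /rank_le eq_sym; have [->|_] //= := eqVneq.
by rewrite /rank_lt (negbTE (arch_lt_irr _)).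
Qed.

Lemma rank_le_anti : antisymmetric rank_le.
Proof.
move=> c d; rewrite /rank_le => /andP[/orP[/eqP //|cd] /orP[/eqP //|dc]].
by have := arch_lt_trans cd dc; rewrite (negbTE (arch_lt_irr _)).
Qed.

Lemma rank_le_trans : transitive rank_le.
Proof.
move=> d c e /orP[/eqP-> //|cd] /orP[/eqP<-|de]; rewrite /rank_le.
  by rewrite cd orbT.
by rewrite /rank_lt (arch_lt_trans de cd) orbT.
Qed.

Lemma rank_le_total : total rank_le.
Proof.
move=> c d; rewrite /rank_le.
have /or3P[dc|eq_cd|cd] := arch_lt_total (val (repr c)) (val (repr d)).
- by rewrite [rank_lt d c]dc !orbT.
- suff -> : c == d by [].
  by rewrite -(arch_class_repr c) -(arch_class_repr d) arch_class_eq.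
- by rewrite [rank_lt c d]cd !orbT.
Qed.

HB.instance Definition _ := Order.isOrder.Build ring_display rank
  rank_lt_def (fun _ _ => erefl) (fun _ _ => erefl)
  rank_le_anti rank_le_trans rank_le_total.

Lemma rank_ltE (x y : nonzero) :
  (arch_class y < arch_class x) = arch_lt (val x) (val y).
Proof.
have hx : arch_equiv (val (repr (arch_class x))) (val x).
  by rewrite -arch_class_eq arch_class_repr.
have hy : arch_equiv (val (repr (arch_class y))) (val y).
  by rewrite -arch_class_eq arch_class_repr.
apply/idP/idP => h.
  by apply: arch_lt_equivl hx _; apply: arch_lt_equivr hy _.
rewrite /Order.lt /= /rank_lt; rewrite arch_equiv_sym in hx.
by rewrite arch_equiv_sym in hy; apply: arch_lt_equivl hx (arch_lt_equivr hy h).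
Qed.

(* None stands for the value oo of 0. *)
Definition nat_val x : option rank := omap arch_class (insub x).

Definition archimedean_on (B : {pred G}) : Prop :=
  forall x y : G, x \in B -> y \in B -> x != 0 -> y != 0 -> arch_equiv x y.

Definition archimedean_subgroup (B : {pred G}) : Prop :=
  zmod_closed B /\ archimedean_on B.

Definition archimedean_component (c : rank) (B : {pred G}) : Prop :=
  [/\ archimedean_subgroup B,
      exists2 x : G, x \in B & nat_val x = Some c
    & forall B' : {pred G}, archimedean_subgroup B' ->
        {subset B <= B'} -> {subset B' <= B}].

End NaturalValuation.

Definition exponential_group (G C : orderedZmodType) : Prop :=
  [/\ archimedean_on (predT : {pred C}),
      exists f : rank G -> G,
        {mono f : c d / c <= d} /\
        forall x : G, (exists c : rank G, f c = x) <-> x < 0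
    & forall c : rank G,
        (exists B : {pred G}, archimedean_component c B) /\
        forall B : {pred G}, archimedean_component c B ->
          ordered_isog B (predT : {pred C})].

(** * The groups attached to a real closed field *)

Section AdditiveGroup.
Variable K : rcfType.

Definition additive_group : Type := K.
HB.instance Definition _ := GRing.Zmodule.on additive_group.
HB.instance Definition _ := Order.Total.on additive_group.

Lemma additive_group_le_total : total (<=%R : rel additive_group).
Proof. exact: le_total. Qed.

Lemma additive_group_leD2l (z x y : additive_group) :
  x <= y -> z + x <= z + y.
Proof. by move=> xy; rewrite (lerD2l (z : K)). Qed.

HB.instance Definition _ :=
  POrderedZmodule_isOrdered.Build additive_group
  additive_group_le_total additive_group_leD2l.

Lemma oabsE (x : K) : oabs (x : additive_group) = `|x|.
Proof. exact: (maxrN x). Qed.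

End AdditiveGroup.

Section PositiveGroup.
Variable K : rcfType.

(* The multiplicative group of positive elements, written additively. *)
Definition positive_group : Type := {x : K | 0 < x}.
HB.instance Definition _ := SubType.on positive_group.
HB.instance Definition _ := Choice.on positive_group.
HB.instance Definition _ :=
  [SubChoice_isSubOrder of positive_group by <: with ring_display].
Implicit Types x y z : positive_group.

Definition pos_one : positive_group := exist _ 1 ltr01.
Definition pos_mul x y : positive_group :=
  exist _ (val x * val y) (mulr_gt0 (valP x) (valP y)).
Lemma pos_inv_subproof x : 0 < (val x)^-1.
Proof. by rewrite invr_gt0; exact: valP. Qed.
Definition pos_inv x : positive_group := exist _ (val x)^-1 (pos_inv_subproof x).

Lemma pos_mulA : associative pos_mul.
Proof. by move=> x y z; apply/val_inj; exact: mulrA. Qed.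
Lemma pos_mulC : commutative pos_mul.
Proof. by move=> x y; apply/val_inj; exact: mulrC. Qed.
Lemma pos_mul1 : left_id pos_one pos_mul.
Proof. by move=> x; apply/val_inj; exact: mul1r. Qed.
Lemma pos_mulV : left_inverse pos_one pos_inv pos_mul.
Proof. by move=> x; apply/val_inj/mulVf/lt0r_neq0; exact: valP. Qed.

HB.instance Definition _ :=
  GRing.isZmodule.Build positive_group pos_mulA pos_mulC pos_mul1 pos_mulV.

Lemma positive_group_le_total : total (<=%R : rel positive_group).
Proof. exact: le_total. Qed.

Lemma positive_group_leD2l z x y : x <= y -> z + x <= z + y.
Proof.
move=> xy; have : val z * val x <= val z * val y by rewrite ler_pM2l ?(valP z).
by [].
Qed.

HB.instance Definition _ :=
  POrderedZmodule_isOrdered.Build positive_group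
  positive_group_le_total positive_group_leD2l.

End PositiveGroup.

Section ValueGroup.
Variable K : rcfType.

Definition value_group : Type := rank (additive_group K).
HB.instance Definition _ := EqQuotient.on value_group.
HB.instance Definition _ := Order.Total.on value_group.

Local Notation nz := (nonzero (additive_group K)).
Implicit Types (x y z : nz) (a b c : value_group).

Definition nz_one : nz := exist _ (1 : K) (oner_neq0 K).
Definition nz_mul x y : nz :=
  exist _ ((val x : K) * (val y : K)) (mulf_neq0 (valP x) (valP y)).
Lemma nz_inv_subproof x : (val x : K)^-1 != 0.
Proof. by rewrite invr_eq0; exact: (valP x). Qed.
Definition nz_inv x : nz := exist _ (val x : K)^-1 (nz_inv_subproof x).

Definition val_class x : value_group := arch_class x.

Definition val_add a b : value_group := val_class (nz_mul (repr a) (repr b)).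
Definition val_opp a : value_group := val_class (nz_inv (repr a)).
Definition val_zero : value_group := val_class nz_one.

Lemma arch_equivP x y :
  reflect (exists n : nat, `|val y : K| <= `|val x : K| *+ n /\
                           `|val x : K| <= `|val y : K| *+ n)
          (arch_equiv (val x) (val y)).
Proof. by apply: (iffP (asboolP _)) => -[n]; rewrite !oabsE => h; exists n. Qed.

Lemma val_class_mul x y x' y' :
  val_class x = val_class x' -> val_class y = val_class y' ->
  val_class (nz_mul x y) = val_class (nz_mul x' y').
Proof.
move=> /eqP; rewrite arch_class_eq => /arch_equivP[n [h1 h2]].
move=> /eqP; rewrite arch_class_eq => /arch_equivP[m [h3 h4]].
apply/eqP; rewrite arch_class_eq; apply/arch_equivP; exists (m * n)%N.
by rewrite /= !normrM; split; rewrite mulrnA -mulrnAr -mulrnAl; apply: ler_pM.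
Qed.

Lemma val_class_inv x x' :
  val_class x = val_class x' -> val_class (nz_inv x) = val_class (nz_inv x').
Proof.
move=> /eqP; rewrite arch_class_eq => /arch_equivP[n [h1 h2]].
apply/eqP; rewrite arch_class_eq; apply/arch_equivP; exists n.
have px : 0 < `|val x : K| by rewrite normr_gt0; exact: (valP x).
have px' : 0 < `|val x' : K| by rewrite normr_gt0; exact: (valP x').
rewrite /= !normfV; split.
  by rewrite -mulr_natl ler_pdivlMr // ler_pdivrMl // mulr_natr.
by rewrite -mulr_natl ler_pdivlMr // ler_pdivrMl // mulr_natr.
Qed.

Lemma val_class_repr a : val_class (repr a) = a.
Proof. exact: arch_class_repr. Qed.

Lemma val_class_M x y :
  val_class (nz_mul x y) = val_add (val_class x) (val_class y).
Proof. by apply: val_class_mul; rewrite val_class_repr. Qed.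

Lemma val_addA : associative val_add.
Proof.
move=> a b c; rewrite -[a]val_class_repr -[b]val_class_repr -[c]val_class_repr.
rewrite -!val_class_M; congr val_class; apply/val_inj; exact: mulrA.
Qed.

Lemma val_addC : commutative val_add.
Proof.
by move=> a b; congr val_class; apply/val_inj; exact: mulrC.
Qed.

Lemma val_add0 : left_id val_zero val_add.
Proof.
move=> a; rewrite -[a]val_class_repr -val_class_M; congr val_class.
apply/val_inj; exact: mul1r.
Qed.

Lemma val_addN : left_inverse val_zero val_opp val_add.
Proof.
move=> a; rewrite -[a in val_add _ a]val_class_repr -val_class_M.
congr val_class; apply/val_inj; apply: mulVf; exact: (valP (repr a)).
Qed.

HB.instance Definition _ :=
  GRing.isZmodule.Build value_group val_addA val_addC val_add0 val_addN.

Lemma val_classM x y : val_class (nz_mul x y) = val_class x + val_class y.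
Proof. exact: val_class_M. Qed.

Lemma val_ltD2l c a b : a < b -> c + a < c + b.
Proof.
rewrite -[a]val_class_repr -[b]val_class_repr -[c]val_class_repr.
rewrite -!val_classM => h; have := h; rewrite !rank_ltE.
move=> /asboolP hb; apply/asboolP => n; have := hb n; rewrite !oabsE /= !normrM.
by rewrite -mulrnAr ltr_pM2l // normr_gt0; exact: (valP (repr c)).
Qed.

Lemma value_group_le_total : total (<=%R : rel value_group).
Proof. exact: le_total. Qed.

Lemma value_group_leD2l c a b : a <= b -> c + a <= c + b.
Proof.
by rewrite le_eqVlt => /orP[/eqP->//|/(val_ltD2l c)/ltW].
Qed.

HB.instance Definition _ :=
  POrderedZmodule_isOrdered.Build value_group
  value_group_le_total value_group_leD2l.

(* v(K^x) together with v(0) = None, the largest element. *)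
Definition fval (x : K) : option value_group := nat_val (x : additive_group K).

Definition fval_ge0 (x : K) : bool := if fval x is Some a then 0 <= a else true.
Definition fval_gt0 (x : K) : bool := if fval x is Some a then 0 < a else true.

Definition val_ring : {pred K} := [pred x | fval_ge0 x].
Definition val_ideal : {pred K} := [pred x | fval_gt0 x].
Definition pos_units : {pred positive_group K} :=
  [pred x | fval (val x) == Some 0].

Lemma val_ringP (x : K) : reflect (exists n : nat, `|x| <= n%:R) (x \in val_ring).
Proof.
rewrite inE /fval_ge0 /fval /nat_val; case: insubP => [u _ ux|] /=.
  rewrite -[0 <= _]negbK -ltNge -[0]/(arch_class nz_one) rank_ltE /= ux.
  apply: (iffP idP) => [/arch_ltNge[n]|[n xn]].
    by rewrite !oabsE normr1 => ?; exists n.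
  apply/asboolPn => /(_ n); rewrite !oabsE normr1.
  by rewrite real_ltNge ?num_real // xn.
rewrite negbK => /eqP ->; apply: (iffP idP) => // _.
by exists 0%N; rewrite normr0.
Qed.

Lemma val_idealP (x : K) :
  reflect (forall n : nat, `|x| *+ n < 1) (x \in val_ideal).
Proof.
rewrite inE /fval_gt0 /fval /nat_val; case: insubP => [u _ ux|] /=.
  rewrite -[0]/(arch_class nz_one) rank_ltE /= ux.
  by apply: (iffP (asboolP _)) => h n; have := h n; rewrite !oabsE normr1.
rewrite negbK => /eqP ->; apply: (iffP idP) => // _ n.
by rewrite normr0 mul0rn.
Qed.

Lemma val_ring_closed : subring_closed val_ring.
Proof.
split.
- by apply/val_ringP; exists 1%N; rewrite normr1.
- move=> x y /val_ringP[n xn] /val_ringP[m ym]; apply/val_ringP.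
  by exists (n + m)%N; rewrite natrD (le_trans (ler_normB _ _)) // lerD.
- move=> x y /val_ringP[n xn] /val_ringP[m ym]; apply/val_ringP.
  by exists (n * m)%N; rewrite normrM natrM ler_pM.
Qed.

HB.instance Definition _ := GRing.isSubringClosed.Build K val_ring
  val_ring_closed.

Definition val_ring_type : Type := {x : K | x \in val_ring}.
HB.instance Definition _ := SubType.on val_ring_type.
HB.instance Definition _ := Choice.on val_ring_type.
HB.instance Definition _ := [SubChoice_isSubComNzRing of val_ring_type by <:].

Definition residue_ideal : {pred val_ring_type} :=
  [pred x | val x \in val_ideal].

Lemma residue_ideal_closed : idealr_closed residue_ideal.
Proof.
split.
- by rewrite inE; apply/val_idealP => n; rewrite normr0 mul0rn.
- rewrite inE; apply/negP => /val_idealP/(_ 1%N).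
  by rewrite normr1 mulr1n ltxx.
move=> a x y; rewrite !inE => /val_idealP hx /val_idealP hy.
have /val_ringP[m am] := valP a; apply/val_idealP => n /=.
rewrite -(@ltr_pMn2r _ 2) // -mulrnA.
apply: (@le_lt_trans _ _ (`|val x| *+ (m * (n * 2)) + `|val y| *+ (n * 2))).
  rewrite (mulrnA _ m) -mulrnDl lerMn2r; apply/orP; right.
  rewrite (le_trans (ler_normD _ _)) // lerD2r normrM -mulr_natl.
  by rewrite ler_wpM2r.
by rewrite mulr2n ltrD.
Qed.

HB.instance Definition _ := isIdealr.Build val_ring_type residue_ideal
  residue_ideal_closed.

End ValueGroup.

Section ResidueField.
Variable K : rcfType.
Local Notation R := (val_ring_type K).
Local Notation mu := (@residue_ideal K).

Definition residue_field : Type := {ideal_quot mu}.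
HB.instance Definition _ := EqQuotient.on residue_field.
HB.instance Definition _ := GRing.ComNzRing.on residue_field.
Implicit Types (x y : R) (a b c : residue_field).

Definition residue x : residue_field := \pi_residue_field x.

Lemma residue_eq x y : (residue x == residue y) = (val x - val y \in @val_ideal K).
Proof. by rewrite /residue piE /Quotient.equiv !inE. Qed.

Lemma residue_repr a : residue (repr a) = a.
Proof. exact: reprK. Qed.

Lemma residueD x y : residue (x + y) = residue x + residue y.
Proof. by rewrite /residue piE. Qed.

Lemma residueM x y : residue (x * y) = residue x * residue y.
Proof. by rewrite /residue piE. Qed.

Lemma residue0 : residue 0 = 0.
Proof. exact: (rmorph0 \pi_{ideal_quot mu}). Qed.

Lemma residue1 : residue 1 = 1.
Proof. exact: (rmorph1 \pi_{ideal_quot mu}). Qed.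

Definition residue_inv a : residue_field :=
  if a == 0 then 0 else residue (insubd (0 : R) (val (repr a))^-1).

Lemma residue_mulV a : a != 0 -> residue_inv a * a = 1.
Proof.
move=> a0; rewrite /residue_inv (negbTE a0).
have : val (repr a) \notin @val_ideal K.
  have := residue_eq (repr a) 0; by rewrite residue_repr residue0 subr0 => <-.
move=> /val_idealP/existsNP[n /negP]; rewrite -real_leNgt ?num_real // => an.
have ra0 : val (repr a) != 0.
  by apply: contraTneq an => ->; rewrite normr0 mul0rn ler10.
have Vin : (val (repr a))^-1 \in @val_ring K.
  apply/val_ringP; exists n; rewrite normfV -[_^-1]mulr1.
  by rewrite ler_pdivrMl ?normr_gt0 // mulr_natr.
rewrite -[a in _ * a]residue_repr -residueM.
have -> : insubd 0 (val (repr a))^-1 * repr a = 1.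
  by apply/val_inj; rewrite /= val_insubd Vin mulVf.
exact: residue1.
Qed.

Lemma residue_inv0 : residue_inv 0 = 0.
Proof. by rewrite /residue_inv eqxx. Qed.

HB.instance Definition _ :=
  GRing.ComNzRing_isField.Build residue_field residue_mulV residue_inv0.

(* Independent of the choice of representatives, see residue_ltE. *)
Definition residue_le a b : bool := val (repr a) <= val (repr b).
Definition residue_lt a b : bool := val (repr a) < val (repr b).

Lemma residue_lt_def a b : residue_lt a b = (b != a) && residue_le a b.
Proof.
rewrite /residue_lt lt_def; congr (~~ _ && _).
by rewrite (inj_eq val_inj) (can_eq (@reprK _ residue_field)).
Qed.

Lemma residue_le_anti : antisymmetric residue_le.
Proof.
move=> a b /le_anti /val_inj h.
by rewrite -(residue_repr a) -(residue_repr b) h.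
Qed.

Lemma residue_le_trans : transitive residue_le.
Proof. by move=> b a c; apply: le_trans. Qed.

Lemma residue_le_total : total residue_le.
Proof. by move=> a b; apply: le_total. Qed.

HB.instance Definition _ := Order.isOrder.Build ring_display residue_field
  residue_lt_def (fun _ _ => erefl) (fun _ _ => erefl)
  residue_le_anti residue_le_trans residue_le_total.

Lemma residue_lt_congr x y x' y' :
  residue x = residue x' -> residue y = residue y' -> residue x != residue y ->
  val x < val y -> val x' < val y'.
Proof.
move=> /eqP xx' /eqP yy'; rewrite residue_eq => xy lt_xy.
rewrite real_ltNge ?num_real //; apply: contra xy => le_yx'.
move: xx' yy'; rewrite !residue_eq => hx hy.
have := rpredB (hx : x - x' \in mu) (hy : y - y' \in mu); rewrite inE.
move=> /val_idealP h; apply/val_idealP => n.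
apply: le_lt_trans (h n); rewrite lerMn2r; apply/orP; right.
rewrite /= distrC ger0_norm ?subr_ge0 ?(ltW lt_xy) // -normrN opprB.
apply: le_trans (ler_norm _).
by rewrite [- (sval x - _)]opprD opprK addrACA lerDl addrC subr_ge0.
Qed.

Lemma residue_ltE x y :
  (residue x < residue y) = (residue x != residue y) && (val x < val y).
Proof.
have [->|neq] := eqVneq (residue x) (residue y); first by rewrite ltxx.
rewrite andTb; have hx := residue_repr (residue x).
have hy := residue_repr (residue y).
by apply/idP/idP; apply: residue_lt_congr; rewrite ?hx ?hy.
Qed.

Lemma residue_field_le_total : total (<=%R : rel residue_field).
Proof. exact: le_total. Qed.

Lemma residue_field_leD2l c a b : a <= b -> c + a <= c + b.
Proof.
rewrite le_eqVlt => /orP[/eqP->//|].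
rewrite -[a]residue_repr -[b]residue_repr -[c]residue_repr -!residueD.
rewrite residue_ltE => /andP[neq lt_ab]; apply/ltW; rewrite residue_ltE.
by rewrite !residueD (inj_eq (addrI _)) neq ltrD2l.
Qed.

HB.instance Definition _ := POrderedZmodule_isOrdered.Build residue_field
  residue_field_le_total residue_field_leD2l.

End ResidueField.

Definition left_exponentiation (K : rcfType) : Prop :=
  exists (A : {pred additive_group K}) (B : {pred positive_group K}),
    [/\ qcomplement A (@val_ring K),
        qcomplement B (@pos_units K)
      & ordered_isog A B].

(* Main.v *)
Require Import Defs.
From mathcomp Require Import all_boot all_order all_algebra.
From mathcomp Require Import boolp.
From mathcomp Require classical_sets.
From mathcomp Require Import ring lra.

Set Implicit Arguments.
Unset Strict Implicit.
Unset Printing Implicit Defensive.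

Import Order.TTheory GRing.Theory Num.Theory.
Local Open Scope ring_scope.

(** Induction in the non-negative cone of the integer part [Z] yields the
function [n |-> 2 ^ n] there, hence a morphism [E] from [Z] to the positive
elements of [K]. Since [E] sends finite integers to units and infinite ones to
infinite elements, and every positive element of [K] is within a factor 2 of
some [E z], the map [lam r := - v (E (floor r))] is a monotone surjective
morphism from [(K, +)] onto the value group [G], with kernel the valuation
ring [R_v]. As [- v] is such a map from the multiplicative group of positive
elements onto [G], with kernel the positive units, any complements of the two
kernels are both isomorphic to [G]: this is left exponentiation. Moreover
[lam] identifies [G] with [K / R_v], whose Archimedean classes are the negative values and whose components are
those of [K], i.e. copies of the residue field. *)

(** * Definable predicates of the non-negative cone and induction for them *)

Section Definability.
Variables (K : realDomainType) (Z : subringClosed K).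
Local Notation M := (nneg_cone Z).

Definition nneg_in (x : K) : bool := (x \in Z) && (0 <= x).

(** Definability is a property of functions and predicates of [K]-valued environments, tested on
    environments from the cone. Formulas then never have to be written out in de Bruijn syntax. *)
Definition definable_term (t : (nat -> K) -> K) : Prop :=
  exists t', forall e : nat -> M,
    sval (eval_term e t') = t (fun i => sval (e i)).

Definition definable (P : (nat -> K) -> Prop) : Prop :=
  exists f, forall e : nat -> M, sat e f <-> P (fun i => sval (e i)).

Lemma definable_var i : definable_term (fun e => e i).
Proof. by exists (TVar i). Qed.

Lemma definable_zero : definable_term (fun=> 0).
Proof. by exists TZero. Qed.

Lemma definable_one : definable_term (fun=> 1).
Proof. by exists TOne. Qed.

Lemma definable_add t u : definable_term t -> definable_term u ->
  definable_term (fun e => t e + u e).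
Proof. by move=> [t' ht] [u' hu]; exists (TAdd t' u') => e /=; rewrite ht hu. Qed.

Lemma definable_mul t u : definable_term t -> definable_term u ->
  definable_term (fun e => t e * u e).
Proof. by move=> [t' ht] [u' hu]; exists (TMul t' u') => e /=; rewrite ht hu. Qed.

Lemma definable_eq t u : definable_term t -> definable_term u ->
  definable (fun e => t e = u e).
Proof.
move=> [t' ht] [u' hu]; exists (FEq t' u') => e /=; rewrite -ht -hu.
by split=> [->//|h]; exact: val_inj.
Qed.

Lemma definable_lt t u : definable_term t -> definable_term u ->
  definable (fun e => t e < u e).
Proof. by move=> [t' ht] [u' hu]; exists (FLt t' u') => e /=; rewrite -ht -hu. Qed.

Lemma definable_le t u : definable_term t -> definable_term u ->
  definable (fun e => t e <= u e).
Proof.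
move=> [t' ht] [u' hu]; exists (FNot (FLt u' t')) => e /=; rewrite -ht -hu.
by rewrite leNgt; split=> /negP.
Qed.

Lemma definable_and P Q : definable P -> definable Q ->
  definable (fun e => P e /\ Q e).
Proof. by move=> [f hf] [g hg]; exists (FAnd f g) => e /=; rewrite hf hg. Qed.

Lemma definable_or P Q : definable P -> definable Q ->
  definable (fun e => P e \/ Q e).
Proof. by move=> [f hf] [g hg]; exists (FOr f g) => e /=; rewrite hf hg. Qed.

Lemma definable_imp P Q : definable P -> definable Q ->
  definable (fun e => P e -> Q e).
Proof. by move=> [f hf] [g hg]; exists (FImply f g) => e /=; rewrite hf hg. Qed.

Lemma definable_iff P Q : definable P -> definable Q ->
  definable (fun e => P e <-> Q e).
Proof. by move=> hP hQ; apply: definable_and; apply: definable_imp. Qed.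

(** [Q] receives the bound variable separately; in the premise, index 0 stands for it and the other
    indices are shifted, as with [env_cons]. *)
Lemma definable_forall (Q : K -> (nat -> K) -> Prop) :
  definable (fun e => Q (e 0%N) (fun i => e i.+1)) ->
  definable (fun e => forall x, nneg_in x -> Q x e).
Proof.
move=> [f hf]; exists (FForall f) => e /=; split=> [h x Nx|h x]; last first.
  by apply/hf; apply: h; exact: (valP x).
by have /hf := h (exist _ x Nx).
Qed.

Lemma definable_exists (Q : K -> (nat -> K) -> Prop) :
  definable (fun e => Q (e 0%N) (fun i => e i.+1)) ->
  definable (fun e => exists2 x, nneg_in x & Q x e).
Proof.
move=> [f hf]; exists (FExists f) => e /=; split=> [[x /hf h]|[x Nx h]].
  by exists (sval x) => //; exact: (valP x).
by exists (exist _ x Nx); apply/hf.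
Qed.

(** Parameters form a finite list read through [nth 0]: the default 0 lies in the cone, so the list
    extends to a full environment. *)
Lemma definable_ind (P : K -> (nat -> K) -> Prop) (s : seq K) :
    (forall f, models_induction M f) ->
    definable (fun e => P (e 0%N) (fun i => e i.+1)) ->
    all nneg_in s -> P 0 (nth 0 s) ->
    (forall x, nneg_in x -> P x (nth 0 s) -> P (x + 1) (nth 0 s)) ->
  forall x, nneg_in x -> P x (nth 0 s).
Proof.
move=> ind [f hf] /allP Ns P0 PS x Nx.
have Nnth i : nneg_in (nth 0 s i).
  have [/(mem_nth 0)/Ns//|si] := ltnP i (size s).
  by rewrite nth_default // /nneg_in rpred0 lexx.
pose e i : M := exist _ (nth 0 s i) (Nnth i).
have hfe y : sat (env_cons y e) f <-> P (sval y) (nth 0 s) := hf (env_cons y e).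
apply: (hfe (exist _ x Nx)).1; apply: ind => [|y /hfe hy]; apply/hfe => //=.
by apply: PS hy; exact: (valP y).
Qed.

End Definability.

Ltac definability :=
  repeat (cbv beta; first
    [ apply: definable_var | apply: definable_zero | apply: definable_one
    | apply: definable_add | apply: definable_mul | apply: definable_eq
    | apply: definable_lt | apply: definable_le
    | apply: definable_and | apply: definable_or
    | apply: definable_forall | apply: definable_exists
    | apply: definable_iff | apply: definable_imp ]).

(** * Coding finite sets in models of Peano Arithmetic *)

Section Coding.
Variables (K : realDomainType) (Z : subringClosed K).
Hypothesis Z_discrete : discretely_ordered Z.
Hypothesis Z_ind : forall f, models_induction (nneg_cone Z) f.
Local Notation N := (nneg_in Z).
Implicit Types b c m k i j n x y : K.

Lemma nneg_in0 : N 0. Proof. by rewrite /nneg_in rpred0 lexx. Qed.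
Lemma nneg_in1 : N 1. Proof. by rewrite /nneg_in rpred1 ler01. Qed.

Lemma nneg_inD x y : N x -> N y -> N (x + y).
Proof. by move=> /andP[? ?] /andP[? ?]; rewrite /nneg_in rpredD ?addr_ge0. Qed.

Lemma nneg_inM x y : N x -> N y -> N (x * y).
Proof. by move=> /andP[? ?] /andP[? ?]; rewrite /nneg_in rpredM ?mulr_ge0. Qed.

Lemma nneg_inB x y : N x -> N y -> y <= x -> N (x - y).
Proof.
by move=> /andP[? ?] /andP[? ?] ?; rewrite /nneg_in rpredB // subr_ge0.
Qed.

Lemma nneg_in_ge0 x : N x -> 0 <= x. Proof. by case/andP. Qed.

Lemma subring_lt_succ x y : x \in Z -> y \in Z -> (x < y + 1) = (x <= y).
Proof.
move=> xZ yZ; rewrite [RHS]leNgt; apply/idP/idP => [xy|]; last first.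
  by rewrite -leNgt => /le_lt_trans -> //; rewrite ltrDl ltr01.
apply/negP => yx; apply: (Z_discrete (rpredB xZ yZ)).
by rewrite subr_gt0 yx ltrBlDl.
Qed.

Lemma nneg_in_lt_succ x y : N x -> N y -> (x < y + 1) = (x <= y).
Proof. by move=> /andP[? _] /andP[? _]; apply: subring_lt_succ. Qed.

Lemma nneg_in_succ_le x y : N x -> N y -> (x + 1 <= y) = (x < y).
Proof. by move=> Nx Ny; rewrite leNgt nneg_in_lt_succ // -ltNge. Qed.

Lemma nneg_in_pred x : N x -> x != 0 -> N (x - 1).
Proof.
move=> Nx x0; apply: nneg_inB => //; first exact: nneg_in1.
by rewrite -[1]add0r nneg_in_succ_le ?nneg_in0 // lt_def x0 nneg_in_ge0.
Qed.

Definition nneg_divides x y := exists2 z, N z & y = x * z.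

Lemma nneg_divides_mull x y z : N z -> nneg_divides x y -> nneg_divides x (y * z).
Proof.
by move=> Nz [w Nw ->]; exists (w * z); rewrite ?mulrA //; apply: nneg_inM.
Qed.

(** A substitute for the factorial: going from [m] to [m + 1] multiplies the witness by [m + 1].
    Stating mere existence keeps the property first-order. *)
Lemma nneg_common_multiple m : N m ->
  exists2 b, N b & 0 < b /\
    forall i, N i -> 0 < i -> i <= m -> nneg_divides i b.
Proof.
move: m; apply: (@definable_ind _ Z (fun m _ => exists2 b, N b & 0 < b /\
    forall i, N i -> 0 < i -> i <= m -> nneg_divides i b) [::]) => //.
- by rewrite /nneg_divides; definability.
- exists 1; first exact: nneg_in1.
  by split=> // i Ni i0 /(lt_le_trans i0); rewrite ltxx.
move=> m Nm [b Nb [b0 hb]]; have Nm1 := nneg_inD Nm nneg_in1.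
exists (b * (m + 1)); first exact: nneg_inM.
split=> [|i Ni i0]; first by rewrite mulr_gt0 // ltr_wpDl ?nneg_in_ge0.
rewrite le_eqVlt => /orP[/eqP ->|]; first by exists b => //; rewrite mulrC.
by rewrite nneg_in_lt_succ // => /hb h; apply: nneg_divides_mull => //; apply: h.
Qed.

(* The moduli [1 + (k + 1) b] are pairwise coprime as soon as [b] is divisible
   by every difference of two indices. *)
Lemma modulus_coprime b c j k : N b -> N c -> N j -> N k -> j != k ->
    nneg_divides `|k - j| b ->
    nneg_divides (1 + (j + 1) * b) (c * (1 + (k + 1) * b)) ->
  nneg_divides (1 + (j + 1) * b) c.
Proof.
move=> Nb Nc Nj Nk jk [w0 Nw0 bE] [z Nz cE].
have [w wZ {w0 Nw0}bE] : exists2 w, w \in Z & b = (k - j) * w.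
  case/andP: Nw0 => w0Z _; case: (ger0P (k - j)) bE => _ ->; first by exists w0.
  by exists (- w0); rewrite ?rpredN // mulrN mulNr.
pose d := 1 + (j + 1) * b.
(* Eliminating [b] between the two moduli leaves [k - j], so [d] divides [c * (k - j)], hence
   [c * b], hence [c = d * c - (j + 1) * (c * b)]; [q] is the resulting quotient. *)
pose q := c - (j + 1) * ((k + 1) * c - (j + 1) * z) * w.
have cq : c = d * q.
  have h : c * (k - j) = d * ((k + 1) * c - (j + 1) * z).
    have -> : d * ((k + 1) * c - (j + 1) * z) = d * (k + 1) * c - (j + 1) * (d * z).
      by ring.
    by rewrite -cE /d; ring.
  have h2 : c * b = d * ((k + 1) * c - (j + 1) * z) * w by rewrite bE mulrA h.
  have -> : d * q = d * c - (j + 1) * (d * ((k + 1) * c - (j + 1) * z) * w).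
    by rewrite /q; ring.
  by rewrite -h2 /d; ring.
have d0 : 0 < d.
  by rewrite ltr_wpDr // mulr_ge0 ?nneg_in_ge0 ?nneg_inD ?nneg_in1.
exists q => //; rewrite /nneg_in.
have : 0 <= d * q by rewrite -cq nneg_in_ge0.
rewrite (pmulr_rge0 _ d0) => ->; rewrite andbT.
case/andP: Nc Nj Nk Nz => cZ _ /andP[jZ _] /andP[kZ _] /andP[zZ _].
by rewrite !(rpredB, rpredD, rpredM, rpred1).
Qed.

(** Membership of [k] in the finite set coded by [(b, c, m)], a divisibility variant of Goedel's
    beta function. *)
Definition coded b c m k := k < m /\ nneg_divides (1 + (k + 1) * b) c.

(** The old [b] need not be divisible by differences with [a], so the set is coded afresh: [b'] is a
    common multiple of all positive numbers up to a larger bound [m'], and [c'] is the product of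
    the moduli of the members. *)
Lemma coded_adjoin b c m a : N b -> N c -> N m -> N a ->
  exists b' c' m', [/\ N b', N c' & N m'] /\
    forall k, N k -> coded b' c' m' k <-> coded b c m k \/ k = a.
Proof.
move=> Nb Nc Nm Na; have Nm' := nneg_inD Nm (nneg_inD Na nneg_in1).
set m' := m + (a + 1) in Nm'.
have mm' : m <= m' by rewrite /m' lerDl addr_ge0 ?ler01 ?nneg_in_ge0.
have am' : a < m' by rewrite -nneg_in_succ_le // ler_wpDl ?nneg_in_ge0.
have [b' Nb' [b'0 hb']] := nneg_common_multiple Nm'.
suff [c' Nc' hc'] : exists2 c', N c' & forall k, N k -> k < m' ->
    (nneg_divides (1 + (k + 1) * b') c' <-> k < m' /\ (coded b c m k \/ k = a)).
  exists b', c', m'; split=> // k Nk; split=> [[km' /hc' []//]|h].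
  have km' : k < m' by case: h => [[/lt_le_trans->]//|->].
  by split=> //; apply/hc'.
(* The product is built by internal induction on [x], which bounds the members treated so far. *)
suff H x : N x -> x <= m' -> exists2 c', N c' & forall k, N k -> k < m' ->
    (nneg_divides (1 + (k + 1) * b') c' <-> k < x /\ (coded b c m k \/ k = a)).
  exact: H.
move: x; apply: (@definable_ind _ Z (fun x e => x <= e 5%N -> exists2 c', N c' &
   forall k, N k -> k < e 5%N ->
    (nneg_divides (1 + (k + 1) * e 4%N) c' <->
     k < x /\ (coded (e 0%N) (e 1%N) (e 2%N) k \/ k = e 3%N)))
  [:: b; c; m; a; b'; m']) => //=.
- by rewrite /coded /nneg_divides; definability.
- by rewrite Nb Nc Nm Na Nb' nneg_inD // nneg_inD ?nneg_in1.
(* The empty product: every modulus exceeds 1, so none divides it. *)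
- move=> _; exists 1; first exact: nneg_in1.
  move=> k Nk _; split=> [[z Nz]|[]]; last by rewrite ltNge nneg_in_ge0.
  have d1 : 1 < 1 + (k + 1) * b'.
    by rewrite ltrDl mulr_gt0 // ltr_wpDl ?nneg_in_ge0.
  have [->|z0] := eqVneq z 0; first by rewrite mulr0 => /eqP; rewrite oner_eq0.
  move=> h; have /nneg_in_ge0 := nneg_in_pred Nz z0; rewrite subr_ge0 => z1.
  suff : 1 < (1 + (k + 1) * b') * z by rewrite -h ltxx.
  apply: lt_le_trans d1 _; rewrite ler_peMr //.
  by rewrite addr_ge0 // mulr_ge0 ?nneg_in_ge0 // nneg_inD ?nneg_in1.
move=> x Nx IH xm; have Nx1 := nneg_inD Nx nneg_in1.
have [|c' Nc' hc'] := IH; first by apply: le_trans xm; rewrite lerDl.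
have xlt : x < m' by apply: lt_le_trans xm; rewrite ltrDl.
have [hx|hx] := pselect (coded b c m x \/ x = a); last first.
  exists c' => // k Nk km; rewrite hc' //; rewrite nneg_in_lt_succ //.
  split=> -[kx h]; split=> //; first exact: ltW.
  by rewrite lt_neqAle kx andbT; apply: contra_notN hx => /eqP <-.
have Nd : N (1 + (x + 1) * b') by rewrite nneg_inD ?nneg_inM ?nneg_in1.
exists (c' * (1 + (x + 1) * b')); first exact: nneg_inM.
move=> k Nk km; have [->|kx] := eqVneq k x.
  split=> _; first by split=> //; rewrite ltrDl.
  by exists c' => //; rewrite mulrC.
have -> : (k < x + 1) = (k < x) by rewrite nneg_in_lt_succ // le_eqVlt (negbTE kx).
(* For [k != x] the moduli of [k] and [x] are coprime, because [|x - k|] is positive and at most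
   [m'], hence divides [b']. The new factor therefore creates no other member. *)
rewrite -hc' //; split; last exact: nneg_divides_mull.
apply: modulus_coprime => //; apply: hb'.
- case: (ger0P (x - k)) => [|/ltW]; first by rewrite subr_ge0; apply: nneg_inB.
  by rewrite subr_le0 opprB; apply: nneg_inB.
- by rewrite normr_gt0 subr_eq0 eq_sym.
rewrite ler_norml; have := nneg_in_ge0 Nk; have := nneg_in_ge0 Nx.
by move=> ? ?; apply/andP; split; lra.
Qed.

Lemma coded_empty k : N k -> ~ coded 0 0 0 k.
Proof. by move=> Nk [/lt_le_trans/(_ (nneg_in_ge0 Nk))]; rewrite ltxx. Qed.

End Coding.

(** * Powers of two *)

Section PowersOfTwo.
Variables (K : realDomainType) (Z : subringClosed K).
Hypothesis Z_discrete : discretely_ordered Z.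
Hypothesis Z_ind : forall f, models_induction (nneg_cone Z) f.
Local Notation N := (nneg_in Z).
Local Notation in_code := (coded Z).
Implicit Types b c m k i j n x y p q : K.

Definition pair_code i x := (i + x) * (i + x) + i.

Lemma pair_code_in i x : N i -> N x -> N (pair_code i x).
Proof. by move=> Ni Nx; rewrite nneg_inD ?nneg_inM ?nneg_inD. Qed.

(** The code of [(i, x)] lies between the consecutive squares of [i + x] and [i + x + 1]; it thus
    determines [i + x], and then [i]. *)
Lemma pair_code_inj i x j y : N i -> N x -> N j -> N y ->
  pair_code i x = pair_code j y -> i = j /\ x = y.
Proof.
suff lt_code s t u v : N s -> N t -> N u -> N v -> s + t < u + v ->
    pair_code s t < pair_code u v.
  move=> Ni Nx Nj Ny E; suff h : i + x = j + y.
    move: E; rewrite /pair_code h => /addrI ij; split=> //.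
    by move: h; rewrite ij => /addrI.
  apply/eqP; rewrite eq_le !leNgt; apply/andP; split; apply/negP.
    by move=> /(lt_code _ _ _ _ Nj Ny Ni Nx); rewrite E ltxx.
  by move=> /(lt_code _ _ _ _ Ni Nx Nj Ny); rewrite E ltxx.
move=> Ns Nt Nu Nv; rewrite -(nneg_in_succ_le Z_discrete) ?nneg_inD // => h.
have := nneg_in_ge0 Ns; have := nneg_in_ge0 Nt; have := nneg_in_ge0 Nu.
by rewrite /pair_code; nra.
Qed.

(* [p = 2 ^ n]: some coded set of pairs contains [(n, p)], and each of its
   elements is [(0, 1)] or arises from another one by [(j, y) |-> (j + 1, 2 y)]. *)
Definition pow2_closed b c m := forall i, N i -> forall x, N x ->
  in_code b c m (pair_code i x) -> i = 0 /\ x = 1 \/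
    exists2 j, N j & exists2 y, N y &
      in_code b c m (pair_code j y) /\ i = j + 1 /\ x = y + y.

Definition pow2 n p := exists2 b, N b & exists2 c, N c & exists2 m, N m &
  in_code b c m (pair_code n p) /\ pow2_closed b c m.

Lemma pow2_0 : pow2 0 1.
Proof.
have N0 := nneg_in0 Z; have N1 := nneg_in1 Z.
have [b [c [m [[Nb Nc Nm] h]]]] :=
  coded_adjoin Z_discrete Z_ind N0 N0 N0 (pair_code_in N0 N1).
exists b => //; exists c => //; exists m => //.
split=> [|i Ni x Nx]; first by apply/h; [exact: pair_code_in|right].
move=> /(h _ (pair_code_in Ni Nx))[/coded_empty[]|]; first exact: pair_code_in.
by move=> /(pair_code_inj Ni Nx N0 N1); left.
Qed.

(** The pair [(n + 1, p + p)] is adjoined to a code witnessing [pow2 n p]. *)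
Lemma pow2S n p : N n -> N p -> pow2 n p -> pow2 (n + 1) (p + p).
Proof.
move=> Nn Np [b Nb [c Nc [m Nm [cnp closed]]]].
have Nn1 := nneg_inD Nn (nneg_in1 Z); have Npp := nneg_inD Np Np.
have [b' [c' [m' [[Nb' Nc' Nm'] h]]]] :=
  coded_adjoin Z_discrete Z_ind Nb Nc Nm (pair_code_in Nn1 Npp).
exists b' => //; exists c' => //; exists m' => //.
split=> [|i Ni x Nx]; first by apply/h; [exact: pair_code_in|right].
move=> /(h _ (pair_code_in Ni Nx))[/(closed _ Ni _ Nx)|].
  case; first by left.
  move=> [j Nj [y Ny [cjy ix]]]; right; exists j => //; exists y => //.
  by split=> //; apply/h; [exact: pair_code_in|left].
move=> /(pair_code_inj Ni Nx Nn1 Npp) ix; right; exists n => //; exists p => //.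
by split=> //; apply/h; [exact: pair_code_in|left].
Qed.

(** Internal induction on the exponent compares two closed codes: a pair with exponent [i + 1] in
    either one comes from a pair with exponent [i], where both agree. *)
Lemma pow2_fun n p q : N n -> N p -> N q -> pow2 n p -> pow2 n q -> p = q.
Proof.
move=> Nn Np Nq [b Nb [c Nc [m Nm [np cl]]]] [b' Nb' [c' Nc' [m' Nm' [nq cl']]]].
suff H i : N i -> forall x, N x -> forall y, N y ->
    in_code b c m (pair_code i x) -> in_code b' c' m' (pair_code i y) -> x = y.
  exact: H nq.
move: i; apply: (@definable_ind _ Z (fun i e => forall x, N x -> forall y, N y ->
   in_code (e 0%N) (e 1%N) (e 2%N) (pair_code i x) ->
   in_code (e 3%N) (e 4%N) (e 5%N) (pair_code i y) -> x = y)
   [:: b; c; m; b'; c'; m']) => //=.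
- by rewrite /pair_code /coded /nneg_divides; definability.
- by rewrite Nb Nc Nm Nb' Nc' Nm'.
- have N0 := nneg_in0 Z.
  have no i : N i -> 0 <> i + 1.
    by move=> /nneg_in_ge0 i0; apply/nesym/eqP; rewrite gt_eqF // ltr_wpDl.
  move=> x Nx y Ny /(cl _ N0 _ Nx)[[_ ->]|[j /no Nj [? _ [_ [/Nj]]]]] //.
  by move=> /(cl' _ N0 _ Ny)[[_ ->]|[j /no Nj [? _ [_ [/Nj]]]]].
move=> i Ni IH x Nx y Ny; have Ni1 := nneg_inD Ni (nneg_in1 Z).
have i1 : i + 1 <> 0.
  by apply/eqP; rewrite gt_eqF // ltr_wpDl // (nneg_in_ge0 Ni).
move=> /(cl _ Ni1 _ Nx)[[/i1//]|[j Nj [u Nu [cju [/addIr ij ->]]]]].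
move=> /(cl' _ Ni1 _ Ny)[[/i1//]|[j' Nj' [u' Nu' [cju' [/addIr ij' ->]]]]].
by rewrite -ij in cju; rewrite -ij' in cju'; rewrite (IH _ Nu _ Nu').
Qed.

Lemma pow2_total n : N n -> exists2 p, N p & pow2 n p.
Proof.
move: n; apply: (@definable_ind _ Z (fun n _ => exists2 p, N p & pow2 n p)
  [::]) => //.
- rewrite /pow2 /pow2_closed /pair_code /coded /nneg_divides.
  by definability.
- by exists 1; [exact: nneg_in1|exact: pow2_0].
- move=> n Nn [p Np np]; exists (p + p); first exact: nneg_inD.
  exact: pow2S.
Qed.

(** Inversion by totality and uniqueness, without opening the code of [(n + 1, q)]. *)
Lemma pow2_pred n q : N n -> N q -> pow2 (n + 1) q ->
  exists2 p, N p & pow2 n p /\ q = p + p.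
Proof.
move=> Nn Nq nq; have [p Np np] := pow2_total Nn; exists p => //; split=> //.
apply: pow2_fun nq _; rewrite ?nneg_inD ?nneg_in1 //; exact: pow2S.
Qed.

Lemma pow2_add n m p q : N n -> N m -> N p -> N q ->
  pow2 n p -> pow2 m q -> pow2 (n + m) (p * q).
Proof.
move=> Nn Nm Np Nq np; move: m Nm q Nq.
apply: (@definable_ind _ Z (fun m e => forall q, N q -> pow2 m q ->
  pow2 (e 0%N + m) (e 1%N * q)) [:: n; p]) => //=.
- rewrite /pow2 /pow2_closed /pair_code /coded /nneg_divides.
  by definability.
- by rewrite Nn Np.
- move=> q Nq /(pow2_fun (nneg_in0 Z) Nq (nneg_in1 Z)) ->; last exact: pow2_0.
  by rewrite addr0 mulr1.
move=> m Nm IH q0 Nq /(pow2_pred Nm Nq)[q Nq' [mq ->]].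
by rewrite addrA mulrDr; apply: pow2S; rewrite ?nneg_inD ?nneg_inM //; apply: IH.
Qed.

(** This growth makes powers with infinite exponents infinite, which later bounds the kernel of the
    map to the value group. *)
Lemma pow2_ge n p : N n -> N p -> pow2 n p -> n + 1 <= p.
Proof.
move=> Nn Np np; move: n Nn p Np np.
apply: (@definable_ind _ Z (fun n e => forall p, N p -> pow2 n p -> n + 1 <= p)
  [::]) => //=.
- rewrite /pow2 /pow2_closed /pair_code /coded /nneg_divides.
  by definability.
- move=> q Nq /(pow2_fun (nneg_in0 Z) Nq (nneg_in1 Z)) ->; last exact: pow2_0.
  by rewrite add0r.
move=> n Nn IH q0 Nq /(pow2_pred Nn Nq)[q Nq' [mq ->]].
have nq := IH _ Nq' mq; rewrite lerD //; apply: le_trans nq.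
by rewrite lerDr (nneg_in_ge0 Nn).
Qed.

(** The integer part of the binary logarithm, taken at [m + 1] because 0 has none. *)
Lemma pow2_log m : N m -> exists2 n, N n & exists2 p, N p &
  pow2 n p /\ p <= m + 1 /\ m + 1 < p + p.
Proof.
move: m; apply: (@definable_ind _ Z (fun m e => exists2 n, N n & exists2 p, N p &
  pow2 n p /\ p <= m + 1 /\ m + 1 < p + p) [::]) => //=.
- rewrite /pow2 /pow2_closed /pair_code /coded /nneg_divides.
  by definability.
- exists 0; first exact: nneg_in0; exists 1; first exact: nneg_in1.
  by rewrite add0r; split; [exact: pow2_0|rewrite ltrDl ltr01 lexx].
move=> m Nm [n Nn [p Np [np [pm mp]]]].
have Nm1 := nneg_inD Nm (nneg_in1 Z); have Nm2 := nneg_inD Nm1 (nneg_in1 Z).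
have Npp := nneg_inD Np Np.
have [lt_mp|le_pm] := ltP (m + 1 + 1) (p + p).
  exists n => //; exists p => //; split=> //; split=> //.
  by apply: le_trans pm _; rewrite lerDl.
(* Here [p + p <= m + 2], while [m + 2 < 4 p] follows from [m + 1 < 2 p] and [1 <= p]. *)
exists (n + 1); first by rewrite nneg_inD ?nneg_in1.
exists (p + p) => //; split; first exact: pow2S.
split=> //; have : 1 <= p.
  by apply: le_trans (pow2_ge Nn Np np); rewrite lerDr (nneg_in_ge0 Nn).
by move: mp => {np pm}; lra.
Qed.

End PowersOfTwo.

(** * Sign rules in ordered abelian groups *)

Section OrderedZmodule.
Variable G : orderedZmodType.
Implicit Types x y : G.

Lemma oz_subr_ge0 x y : (0 <= y - x) = (x <= y).
Proof.
apply/idP/idP => [/(oz_leD2l x)|/(oz_leD2l (- x))].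
  by rewrite addr0 addrC subrK.
by rewrite addNr addrC.
Qed.

Lemma oz_oppr_le0 x : (- x <= 0) = (0 <= x).
Proof. by rewrite -(oz_subr_ge0 (- x)) sub0r opprK. Qed.

Lemma oz_oppr_ge0 x : (0 <= - x) = (x <= 0).
Proof. by rewrite -sub0r oz_subr_ge0. Qed.

Lemma oz_leN2 x y : (- x <= - y) = (y <= x).
Proof. by rewrite -(oz_subr_ge0 (- x)) opprK addrC oz_subr_ge0. Qed.

End OrderedZmodule.

(* Surjective monotone group morphisms with kernel [H], i.e. quotients of
   ordered groups by the convex subgroup [H]. *)
Definition order_quotient (V G : orderedZmodType) (H : {pred V}) (f : V -> G)
    : Prop :=
  [/\ {morph f : x y / x + y},
      forall x, 0 <= x -> 0 <= f x,
      forall x, f x = 0 <-> x \in H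
    & forall g, exists x, f x = g].

(** * The base 2 exponential on the integer part *)

Section Exponential.
Variables (K : rcfType) (Z : subringClosed K).
Hypothesis Z_int : integer_part Z.
Hypothesis Z_ind : forall f, models_induction (nneg_cone Z) f.
Local Notation N := (nneg_in Z).
Local Notation P := (positive_group K).

Lemma nneg_cone_exp : exists E : K -> P,
  [/\ forall n m, N n -> N m -> E (n + m) = E n + E m,
      val (E 1) = 2,
      forall n, N n -> n + 1 <= val (E n)
    & forall r : K, 1 <= r ->
        exists2 n, N n & val (E n) <= r /\ r <= val (E n) * 2].
Proof.
have [Zd Zi] := Z_int.
have [|E0 E0P] := @choice _ _ (fun n p => N n -> N p /\ pow2 Z n p).
  move=> n.
  have [Nn|] := boolP (N n); last by exists 0.
  by have [p Np np] := pow2_total Zd Z_ind Nn; exists p.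
have E0_gt0 n : N n -> 0 < E0 n.
  move=> Nn; have [Np /(pow2_ge Zd Z_ind Nn Np)] := E0P n Nn.
  by apply: lt_le_trans; rewrite ltr_wpDl // (nneg_in_ge0 Nn).
have E0_fun n p : N n -> N p -> pow2 Z n p -> E0 n = p.
  by move=> Nn Np; have [? ?] := E0P n Nn; apply: pow2_fun.
(* [E0] is positive on the cone; elsewhere its values are arbitrary, and [insubd] replaces those
   that are not positive by 1. *)
pose E n : P := insubd (pos_one K) (E0 n).
have valE n : N n -> val (E n) = E0 n by move=> /E0_gt0 h; rewrite val_insubd h.
exists E; split.
- move=> n m Nn Nm; have [Np np] := E0P n Nn; have [Nq mq] := E0P m Nm.
  apply/val_inj; rewrite valE ?nneg_inD // [RHS]/=.
  rewrite [val (E n)]valE // [val (E m)]valE //.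
  by apply: E0_fun; rewrite ?nneg_inD ?nneg_inM //; apply: pow2_add.
- rewrite valE ?nneg_in1 //; apply: E0_fun; rewrite ?nneg_inD ?nneg_in1 //.
  have := pow2S Zd Z_ind (nneg_in0 Z) (nneg_in1 Z) (pow2_0 Zd Z_ind).
  by rewrite add0r.
- by move=> n Nn; rewrite valE //; have [Np] := E0P n Nn; apply: pow2_ge.
- move=> r r1; have [z zZ /andP[zr rz]] := Zi r.
  (* The floor [z] of [r] is at least 1, and [pow2_log] at [z - 1] gives [p <= z < p + p]. By
     discreteness [z + 1 <= p + p], which also bounds [r]. *)
  have Nz : N (z - 1).
    rewrite /nneg_in rpredB ?rpred1 // subr_ge0.
    by rewrite -(subring_lt_succ Zd) ?rpred1 // (le_lt_trans r1).
  have [n Nn [p Np [np []]]] := pow2_log Zd Z_ind Nz; rewrite subrK => pz.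
  rewrite -(nneg_in_succ_le Zd) ?nneg_inD //; last first.
    by rewrite -[z](subrK 1) nneg_inD ?nneg_in1.
  move=> zp; exists n => //; rewrite valE // (E0_fun n p) //.
  split; first exact: le_trans zr.
  by rewrite mulr_natr mulr2n (le_trans (ltW rz)).
Qed.

(** An additive map on the cone extends to differences by [F (x - y) = E x - E y]; the target is
    written additively, so this is a quotient of powers. *)
Lemma subring_exp : exists E : K -> P,
  [/\ forall z w, z \in Z -> w \in Z -> E (z + w) = E z + E w,
      val (E 1) = 2,
      forall z, z \in Z -> 0 <= z -> z + 1 <= val (E z)
    & forall x : P, exists2 z, z \in Z &
        val (E z) <= val x * 2 /\ val x <= val (E z) * 2].
Proof.
have [E [E_D E1 E_ge E_log]] := nneg_cone_exp.
pose pp z : K := Num.max z 0; pose np z : K := Num.max (- z) 0.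
have Npp z : z \in Z -> N (pp z).
  move=> zZ; rewrite /pp /nneg_in le_max lexx orbT andbT.
  by case: leP => _; rewrite ?rpred0.
have Nnp z : z \in Z -> N (np z) by rewrite -rpredN; apply: Npp.
have pnE z : z = pp z - np z.
  rewrite /pp /np; case: (lerP z 0) => h.
    by rewrite max_l ?oppr_ge0 // sub0r opprK.
  by rewrite max_r ?subr0 // oppr_le0 ltW.
pose F z := E (pp z) - E (np z).
(* The value does not depend on how the integer is written as a difference; additivity of [F]
   follows. *)
have FE x y : N x -> N y -> F (x - y) = E x - E y.
  move=> Nx Ny; have [xZ yZ] : x \in Z /\ y \in Z by case/andP: Nx; case/andP: Ny.
  have zZ : x - y \in Z by rewrite rpredB.
  have h : pp (x - y) + y = x + np (x - y).
    by have := pnE (x - y); move: (pp _) (np _) => a b h; lra.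
  have /(canRL (addrK _)) h2 : E (pp (x - y)) + E y = E x + E (np (x - y)).
    by rewrite -E_D ?Npp // h E_D ?Nnp.
  by rewrite /F h2 addrAC addrK.
have N0 := nneg_in0 Z; have N1 := nneg_in1 Z.
have E0 : E 0 = 0.
  by apply: (addrI (E 0)); rewrite -E_D // !addr0.
have FN x : N x -> F x = E x by move=> Nx; rewrite -[x]subr0 FE // E0 !subr0.
exists F; split.
- move=> z w zZ wZ; rewrite {1}[z]pnE {1}[w]pnE.
  have -> : pp z - np z + (pp w - np w) = pp z + pp w - (np z + np w) by ring.
  have [Npz Npw Nnz Nnw] : [/\ N (pp z), N (pp w), N (np z) & N (np w)].
    by split; [exact: Npp|exact: Npp|exact: Nnp|exact: Nnp].
  by rewrite (FE _ _ (nneg_inD Npz Npw) (nneg_inD Nnz Nnw)) !E_D // /F opprD addrACA.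
- by rewrite FN.
- by move=> z zZ z0; rewrite FN ?E_ge // /nneg_in zZ.
move=> x; have x0 := valP x; have [x1|x1] := leP 1 (val x).
  have [n Nn [h1 h2]] := E_log _ x1; exists n; first by case/andP: Nn.
  by rewrite FN // h2; split=> //; rewrite (le_trans h1) // ler_peMr ?ler1n ?ltW.
(* Below 1 the estimate comes from the inverse. Inversion moves the factor 2 to the other
   inequality, hence its presence in both. *)
have [|n Nn [h1 h2]] := E_log (val x)^-1; first by rewrite invf_ge1 ?ltW.
exists (- n); first by case/andP: Nn; rewrite rpredN.
have En0 := valP (E n).
have [VE0 VE] : 0 < (val (E n))^-1 /\ val (F (- n)) = (val (E n))^-1.
  by rewrite invr_gt0 En0 -[- n]sub0r FE // E0 sub0r.
rewrite {}VE; split.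
  by rewrite -[_^-1]mulr1 ler_pdivrMl // mulrCA -ler_pdivrMl // mulr1.
have : val x <= (val (E n))^-1 by rewrite -[val x]invrK lef_pV2 ?posrE ?invr_gt0.
by move=> h; apply: le_trans h _; rewrite ler_peMr ?ler1n ?ltW.
Qed.

End Exponential.

(** * The valuation as a quotient map of the multiplicative group *)

Section MinusValuation.
Variable K : rcfType.
Local Notation P := (positive_group K).
Local Notation G := (value_group K).
Local Notation nz := (nonzero (additive_group K)).

Definition pos_nonzero (x : P) : nz := exist _ (val x : K) (lt0r_neq0 (valP x)).

(* The sign makes the map order preserving. *)
Definition minus_val (x : P) : G := - val_class (pos_nonzero x).

Lemma minus_valD : {morph minus_val : x y / x + y}.
Proof.
move=> x y; rewrite /minus_val -opprD -val_classM; congr (- val_class _).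
exact/val_inj.
Qed.

Lemma minus_val0 : minus_val 0 = 0.
Proof. by apply: (addrI (minus_val 0)); rewrite -minus_valD !addr0. Qed.

Lemma minus_valN : {morph minus_val : x / - x}.
Proof.
move=> x; apply: (addrI (minus_val x)).
by rewrite -minus_valD !subrr minus_val0.
Qed.

Lemma minus_val_le (x y : P) :
  minus_val x <= minus_val y <-> exists n : nat, val x <= val y *+ n.
Proof.
rewrite /minus_val oz_leN2 leNgt [_ < _]rank_ltE /=.
have absE (z : P) : oabs (val z : additive_group K) = val z.
  by rewrite oabsE ger0_norm // ltW // (valP z).
split=> [/arch_ltNge[n]|[n xy]]; first by rewrite !absE; exists n.
by apply/asboolPn => /(_ n); rewrite !absE oz_ltNge xy.
Qed.

Lemma minus_val_ge0 (x : P) : 0 <= x -> 0 <= minus_val x.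
Proof. by move=> x0; rewrite -minus_val0; apply/minus_val_le; exists 1%N. Qed.

Lemma minus_val_surj (g : G) : exists x : P, minus_val x = g.
Proof.
pose y := repr (- g); have y0 : 0 < `|val y : K| by rewrite normr_gt0 (valP y).
exists (exist _ `|val y : K| y0); rewrite /minus_val -[RHS]opprK; congr (- _).
rewrite -[- g]val_class_repr; apply/eqP; rewrite arch_class_eq.
by apply/arch_equivP; exists 1%N; rewrite /= normr_id mulr1n.
Qed.

Lemma minus_val_eq0 (x : P) : minus_val x = 0 <-> x \in @pos_units K.
Proof.
rewrite inE /fval /nat_val /minus_val.
rewrite (insubT (fun y : additive_group K => y != 0) (lt0r_neq0 (valP x))) /=.
have -> : Sub (val x) (lt0r_neq0 (valP x)) = pos_nonzero x by apply/val_inj.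
split=> [/eqP|/eqP[h]]; first by rewrite oppr_eq0 => /eqP h; apply/eqP; congr Some.
by apply/eqP; rewrite oppr_eq0; apply/eqP.
Qed.

Lemma minus_val_quotient : order_quotient (@pos_units K) minus_val.
Proof.
split; [exact: minus_valD|exact: minus_val_ge0|exact: minus_val_eq0|].
exact: minus_val_surj.
Qed.

End MinusValuation.

(** * The value group as a quotient of the additive group *)

Section LeftLogarithm.
Variables (K : rcfType) (Z : subringClosed K).
Hypothesis Z_int : integer_part Z.
Hypothesis Z_ind : forall f, models_induction (nneg_cone Z) f.
Local Notation mu := (@minus_val K).

Lemma value_group_quotient : exists f : additive_group K -> value_group K,
  @order_quotient (additive_group K) _ (@val_ring K) f.
Proof.
have [Zd Zi] := Z_int; have [E [E_D E1 E_ge E_log]] := subring_exp Z_int Z_ind.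
have E0 : E 0 = 0.
  by apply: (addrI (E 0)); rewrite -E_D ?rpred0 // !addr0.
have EN z : z \in Z -> E (- z) = - E z.
  by move=> zZ; apply: (addrI (E z)); rewrite -E_D ?rpredN // !subrr.
have natZ n : n%:R \in Z by rewrite rpred_nat.
have EX n : val (E n%:R) = 2 ^+ n.
  elim: n => [|n IHn]; first by rewrite E0.
  by rewrite -natr1 E_D ?rpred1 // exprSr -IHn -E1.
have E_ge1 z : z \in Z -> 0 <= z -> 1 <= val (E z).
  by move=> zZ z0; apply: le_trans (E_ge z zZ z0); rewrite lerDr.
(* For [0 <= z <= n] one has [E z <= E n = 2 ^ n], since [1 <= E (n - z)]: finite integers go to
   units. *)
have mu_E_fin z : z \in Z -> z \in @val_ring K -> mu (E z) = 0.
  wlog z0 : z / 0 <= z => [hw|] zZ zfin.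
    have [/hw|/ltW z0] := leP 0 z; first exact.
    apply: oppr_inj; rewrite oppr0 -minus_valN -EN //.
    by apply: hw; rewrite ?oppr_ge0 ?rpredN.
  have /val_ringP[n] := zfin; rewrite ger0_norm // => zn.
  apply/le_anti/andP; split; last by apply: minus_val_ge0; apply: E_ge1.
  rewrite -[X in _ <= X](minus_val0 K); apply/minus_val_le; exists (2 ^ n)%N.
  rewrite -[n%:R](subrK z) in zn *.
  have -> : (val (0 : positive_group K)) *+ 2 ^ n = 2 ^+ n :> K by rewrite natrX.
  rewrite -EX -[n%:R](subrK z) E_D ?rpredB //.
  have h := E_ge1 (n%:R - z); rewrite [leRHS]/= ler_peMl ?h ?rpredB ?subr_ge0 //.
  - exact: ltW (valP (E z)).
  - by move: zn; rewrite subrK.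
have [fl flP] := @choice _ _ (fun r z => z \in Z /\ z <= r < z + 1)
  (fun r => let: ex_intro2 z h1 h2 := Zi r in ex_intro _ z (conj h1 h2)).
have flZ r : fl r \in Z by case: (flP r).
have fl_le r : fl r <= r by case: (flP r) => _ /andP[].
have lt_fl r : r < fl r + 1 by case: (flP r) => _ /andP[].
have sub_fl_fin r : r - fl r \in @val_ring K.
  apply/val_ringP; exists 1%N; rewrite ger0_norm ?subr_ge0 ?fl_le //.
  by have := lt_fl r; lra.
have fl_fin r : (fl r \in @val_ring K) = (r \in @val_ring K).
  by rewrite -[in RHS](subrK (fl r) r) rpredDl.
pose lam (r : K) := mu (E (fl r)).
have lamD r s : lam (r + s) = lam r + lam s.
  (* The floor is additive up to a bounded integer [d], which contributes nothing after [E] and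
     [mu]. *)
  have [d [dZ dfin dE]] : exists d,
      [/\ d \in Z, d \in @val_ring K & fl (r + s) = fl r + fl s + d].
    exists (fl (r + s) - fl r - fl s); split; [by rewrite !rpredB| |by ring].
    apply/val_ringP; exists 2%N; rewrite ler_norml.
    have := (fl_le r, lt_fl r, fl_le s, lt_fl s, fl_le (r + s), lt_fl (r + s)).
    by move=> [] [] [] [] []; lra.
  rewrite /lam dE (E_D _ _ (rpredD (flZ r) (flZ s)) dZ) E_D // !minus_valD.
  by rewrite (mu_E_fin d) ?addr0.
have lam_ge0 r : 0 <= r -> 0 <= lam r.
  move=> r0; apply: minus_val_ge0; apply: E_ge1 => //.
  by rewrite -(subring_lt_succ Zd) ?rpred0 // (le_lt_trans r0).
have lam_E z : z \in Z -> lam z = mu (E z).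
  move=> zZ; rewrite -[in RHS](subrK (fl z) z) E_D ?rpredB // minus_valD.
  by rewrite (mu_E_fin _ (rpredB zZ (flZ z)) (sub_fl_fin z)) add0r.
exists lam; split=> //.
- move=> r; rewrite -fl_fin; split=> [|]; last exact: mu_E_fin.
  rewrite /lam; move: (fl r) (flZ r) => z; wlog z0 : z / 0 <= z => [hw|] zZ Ez.
    have [/hw|/ltW z0] := leP 0 z; first exact.
    rewrite -rpredN; apply: hw; rewrite ?oppr_ge0 ?rpredN //.
    by rewrite EN // minus_valN Ez oppr0.
  (* If [E z] is a unit, it is at most some natural number [n], and [z + 1 <= E z] bounds [z]
     too. *)
  have /minus_val_le[n] : mu (E z) <= mu 0 by rewrite Ez minus_val0.
  have := E_ge z zZ z0 => h1 h2; apply/val_ringP; exists n; rewrite ger0_norm //.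
  by apply: le_trans h2; apply: le_trans h1; rewrite lerDl.
(* Surjectivity: some [E z] is within a factor 2 of [x], hence has the same valuation. *)
move=> g; have [x <-] := minus_val_surj g; have [z zZ [h1 h2]] := E_log x.
exists z; rewrite lam_E //; apply/le_anti/andP.
by split; apply/minus_val_le; exists 2%N; rewrite -mulr_natr.
Qed.

End LeftLogarithm.

(** * Complements and quotients of ordered groups *)

Section Complements.
Variable V : zmodType.
Implicit Types (A H : {pred V}) (x y : V) (n : nat).

Definition division_closed A := forall n x, (0 < n)%N -> x *+ n \in A -> x \in A.

Definition divisible := forall n x, (0 < n)%N -> exists y, y *+ n = x.

Definition torsion_free := forall n x, (0 < n)%N -> x *+ n = 0 -> x = 0.

Lemma zmod_closed_mulrn A n x : zmod_closed A -> x \in A -> x *+ n \in A.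
Proof.
move=> cA xA; have [A0 AB] := cA; elim: n => [|n IHn]; first by rewrite mulr0n.
rewrite mulrS -[x *+ n]opprK.
by apply: (AB) => //; rewrite -sub0r; apply: (AB).
Qed.

Lemma zmod_closed_mulrz A (m : int) x : zmod_closed A -> x \in A -> x *~ m \in A.
Proof.
move=> cA xA; have [A0 AB] := cA; case: m => n.
  exact: zmod_closed_mulrn.
by rewrite NegzE mulrNz -sub0r; apply: (AB) => //; apply: zmod_closed_mulrn.
Qed.

Lemma division_closed_mulrz A (m : int) x : zmod_closed A -> division_closed A ->
  m != 0 -> x *~ m \in A -> x \in A.
Proof.
move=> cA dA m0 xm; have [A0 AB] := cA.
apply: (dA `|m|%N); first by rewrite absz_gt0.
case: m xm m0 => n //= xm _; rewrite NegzE mulrNz in xm.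
by rewrite -[_ *+ _]opprK -sub0r; apply: (AB).
Qed.

Lemma zmod_closedD A x y : zmod_closed A -> x \in A -> y \in A -> x + y \in A.
Proof.
by move=> [A0 AB] xA yA; rewrite -[y]opprK; apply: (AB) => //; rewrite -sub0r AB.
Qed.

Lemma divisible_mulrz (m : int) x : divisible -> m != 0 -> exists y, y *~ m = x.
Proof.
move=> divV m0; have [|y <-] := divV `|m|%N x; first by rewrite absz_gt0.
case: m m0 => n /= _; first by exists y.
by exists (- y); rewrite NegzE mulrNz mulNrz opprK.
Qed.

Lemma torsion_free_mulrz (m : int) x : torsion_free -> m != 0 -> x *~ m = 0 -> x = 0.
Proof.
move=> tfV m0 xm; apply: (tfV `|m|%N); first by rewrite absz_gt0.
case: m m0 xm => n //= _; rewrite NegzE mulrNz => /eqP.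
by rewrite oppr_eq0 => /eqP.
Qed.

(** Rational scaling is multiplication by the numerator followed by division by the denominator. *)
Lemma qsubspace_division_closed A :
  zmod_closed A -> division_closed A -> qsubspace A.
Proof.
move=> cA dA; split=> // q u v uA; rewrite /is_qscale => uv.
apply: (division_closed_mulrz cA dA (denq_neq0 q)).
by rewrite uv; apply: zmod_closed_mulrz.
Qed.

(** Zorn's lemma gives a maximal division-closed subgroup meeting [H] trivially. Were some [x0]
    outside its sum with [H], adjoining [x0] would contradict maximality. *)
Lemma qcomplement_exists H : divisible -> torsion_free ->
  zmod_closed H -> division_closed H -> exists A : {pred V}, qcomplement A H.
Proof.
move=> divV tfV cH dH.
(* [0] is adjoined to [X], so that the empty chain has an upper bound. *)
pose add0 (X : classical_sets.set V) x := x = 0 \/ X x.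
pose good (X : classical_sets.set V) :=
 [/\ forall x y, add0 X x -> add0 X y -> add0 X (x - y),
  forall n x, (0 < n)%N -> add0 X (x *+ n) -> add0 X x
  & forall x, add0 X x -> x \in H -> x = 0].
have [F Fgood Ftot|X [[XB Xdiv XH] Xmax]] :=
    @classical_sets.Zorn_bigcup V good.
  set U := classical_sets.bigcup _ _.
  have sub_U Y x : F Y -> add0 Y x -> add0 U x.
    by move=> FY [->|Yx]; [left|right; exists Y].
  have U1 x : add0 U x -> x = 0 \/ exists2 Y, F Y & add0 Y x.
    by move=> [->|[Y FY Yx]]; [left|right; exists Y => //; right].
  split=> [x y Ux Uy|n x n0 /U1|x /U1].
  - have [x0|[X FX Xx]] := U1 _ Ux; have [y0|[Y FY Yy]] := U1 _ Uy.
    + by left; rewrite x0 y0 subrr.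
    + by apply: (sub_U _ _ FY); have [h _ _] := Fgood _ FY; apply: h => //; left.
    + by apply: (sub_U _ _ FX); have [h _ _] := Fgood _ FX; apply: h => //; left.
    have [XY|YX] := Ftot _ _ FX FY.
      apply: (sub_U _ _ FY); have [h _ _] := Fgood _ FY; apply: h => //.
      by case: Xx => [->|/XY]; [left|right].
    apply: (sub_U _ _ FX); have [h _ _] := Fgood _ FX; apply: h => //.
    by case: Yy => [->|/YX]; [left|right].
  - case=> [/tfV -> //|[Y FY Yx]]; first by left.
    by apply: (sub_U _ _ FY); have [_ h _] := Fgood _ FY; apply: h Yx.
  - by case=> [//|[Y FY Yx]]; have [_ _ h] := Fgood _ FY; apply: h.
pose A : {pred V} := fun x => `[< add0 X x >].
have AP x : reflect (add0 X x) (x \in A) by apply: asboolP.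
have cA : zmod_closed A.
  by split=> [|x y /AP hx /AP hy]; apply/AP; [left|apply: XB].
have dA : division_closed A by move=> n x n0 /AP h; apply/AP; apply: Xdiv h.
have [A0 AB] := cA; have [H0 HB] := cH.
exists A; split=> [|x /AP|x0]; [exact: qsubspace_division_closed|exact: XH|].
apply: contrapT => x0AH.
(* [B] is the rational span of [A] and [x0], with denominators cleared. *)
pose B v := exists n, exists m : int, exists2 a,
  a \in A & (0 < n)%N /\ v *+ n = a + x0 *~ m.
have sub_B v : add0 X v -> B v.
  by move=> /AP vA; exists 1%N, 0, v => //; rewrite mulr1n mulr0z addr0.
have Bx0 : B x0 by exists 1%N, 1, 0 => //; rewrite mulr1n mulr1z add0r.
have x0X : ~ X x0.
  by move=> h; apply: x0AH; exists x0; [apply/AP; right|exists 0; rewrite ?addr0].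
apply: (Xmax B).
  by split=> [v Xv|/(_ x0 Bx0)//]; apply: sub_B; right.
have B0 v : add0 B v -> B v by case=> [->|//]; apply: sub_B; left.
split=> [v w /B0[n [m [a aA [n0 vE]]]] /B0[n' [m' [a' aA' [n0' wE]]]]|n v n0|v /B0].
- right; exists (n * n')%N, (m * n'%:Z - m' * n%:Z), (a *+ n' - a' *+ n).
    by apply: (AB); apply: zmod_closed_mulrn.
  rewrite muln_gt0 n0; split=> //.
  rewrite mulrnBl mulrnA vE mulnC mulrnA wE !mulrnDl opprD addrACA; congr (_ + _).
  by rewrite mulrzBr !mulrzA !pmulrn.
- move=> /B0[k [m [a aA [k0 vE]]]]; right; exists (n * k)%N, m, a => //.
  by rewrite muln_gt0 n0 mulrnA.
(* For [v] in both [B] and [H]: if [m = 0], a multiple of [v] lies in both [A] and [H]. Otherwise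
   [c = - a / m] lies in [A] and [x0 - c = n v / m] in [H], so [x0] was in the sum after all. *)
move=> [n [m [a aA [n0 vE]]]] vH.
have [m0|m0] := eqVneq m 0.
  apply: tfV n0 _; apply: XH; first by rewrite vE m0 mulr0z addr0; apply/AP.
  exact: zmod_closed_mulrn.
have [c cE] := divisible_mulrz (- a) divV m0.
have cA' : c \in A.
  by apply: (division_closed_mulrz cA dA m0); rewrite cE -sub0r; apply: (AB).
case: x0AH; exists c => //; exists (x0 - c); last by rewrite addrC subrK.
apply: (division_closed_mulrz cH dH m0); rewrite mulrzBl cE opprK addrC -vE.
exact: zmod_closed_mulrn.
Qed.

End Complements.

(** * Isomorphism of complements of kernels *)

Section OrderedGroupMorphisms.

Lemma oz_additive_mono (V W : orderedZmodType) (A : {pred V}) (f : V -> W) :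
    zmod_closed A -> {in A &, {morph f : x y / x + y}} ->
    (forall x, x \in A -> 0 < x -> 0 < f x) ->
  {in A &, {mono f : x y / x <= y}}.
Proof.
move=> cA fD f_gt0; have [A0 AB] := cA.
have lt_f x y : x \in A -> y \in A -> x < y -> f x < f y.
  move=> xA yA xy; rewrite -[y](subrK x) fD ?AB //.
  rewrite -[X in X < _]add0r ![_ + f x]addrC.
  apply: oz_ltD2l; apply: f_gt0; rewrite ?AB //.
  by have := oz_ltD2l (- x) xy; rewrite addNr addrC.
move=> x y xA yA; apply/idP/idP => [|]; last first.
  by rewrite le_eqVlt => /orP[/eqP->//|/(lt_f _ _ xA yA)/ltW].
by rewrite !oz_leNgt; apply: contra; apply: lt_f.
Qed.

Lemma order_quotient0 (V G : orderedZmodType) H (f : V -> G) :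
  order_quotient H f -> f 0 = 0.
Proof. by move=> [fD _ _ _]; apply: (addrI (f 0)); rewrite -fD !addr0. Qed.

Lemma order_quotientN (V G : orderedZmodType) H (f : V -> G) :
  order_quotient H f -> {morph f : x / - x}.
Proof.
move=> qf x; have [fD _ _ _] := qf.
by apply: (addrI (f x)); rewrite -fD !subrr (order_quotient0 qf).
Qed.

Lemma order_quotient_lt (V G : orderedZmodType) H (f : V -> G) x y :
  order_quotient H f -> f x < f y -> x < y.
Proof.
move=> qf; have [fD f_ge0 _ _] := qf; rewrite !oz_ltNge; apply: contra.
rewrite -oz_subr_ge0 => /f_ge0; rewrite fD (order_quotientN qf).
by rewrite oz_subr_ge0.
Qed.

(** A quotient map is injective on a complement of its kernel and still reaches all of [G] from it.
    The isomorphism [h] sends [x] to the unique [b] in [B] with [g b = f x]. *)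
Lemma order_quotient_isog (V W G : orderedZmodType) (HV : {pred V})
    (HW : {pred W}) (f : V -> G) (g : W -> G) (A : {pred V}) (B : {pred W}) :
    order_quotient HV f -> order_quotient HW g ->
    qcomplement A HV -> qcomplement B HW ->
  ordered_isog A B.
Proof.
move=> qf qg [[cA _] AH A_all] [[cB _] BH B_all].
have [fD f_ge0 f_eq0 _] := qf; have [gD g_ge0 g_eq0 g_surj] := qg.
have [A0 AB] := cA; have [B0 BB] := cB.
have gB_inj b b' : b \in B -> b' \in B -> g b = g b' -> b = b'.
  move=> bB bB' gbb'; apply/eqP; rewrite -subr_eq0; apply/eqP.
  apply: BH; first exact: BB.
  by apply/g_eq0; rewrite gD (order_quotientN qg) gbb' subrr.
have fA_inj a a' : a \in A -> a' \in A -> f a = f a' -> a = a'.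
  move=> aA aA' faa'; apply/eqP; rewrite -subr_eq0; apply/eqP.
  apply: AH; first exact: AB.
  by apply/f_eq0; rewrite fD (order_quotientN qf) faa' subrr.
have [|h hP] := @choice _ _ (fun x b => b \in B /\ g b = f x).
  move=> x; have [w <-] := g_surj (f x); have [b bB [u uH ->]] := B_all w.
  by exists b; rewrite gD (proj2 (g_eq0 u) uH) addr0.
have hB x : h x \in B by case: (hP x).
have gh x : g (h x) = f x by case: (hP x).
have hD : {morph h : x y / x + y}.
  move=> x y; apply: gB_inj => //; first exact: zmod_closedD.
  by rewrite gD !gh fD.
exists h; split=> [x _|x y _ _||y yB].
- exact: hB.
- exact: hD.
- apply: oz_additive_mono => // x xA x0.
  have fx0 : 0 < f x.
    rewrite lt_neqAle f_ge0 ?ltW // andbT; apply: contraTneq x0 => fx0.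
    by rewrite (fA_inj x 0) ?ltxx // (order_quotient0 qf).
  by apply: (order_quotient_lt qg); rewrite gh (order_quotient0 qg).
have [x fx] : exists x, f x = g y by case: qf => _ _ _; apply.
have [a aA [u uH xE]] := A_all x; exists a => //.
apply: gB_inj => //; rewrite gh -fx xE fD (proj2 (f_eq0 u) uH) ?addr0 //.
Qed.

End OrderedGroupMorphisms.

(** * Archimedean classes and existence of components *)

Section ArchimedeanClasses.
Variable G : orderedZmodType.
Implicit Types x y z u : G.

Lemma oabs_ge x : 0 <= x -> oabs x = x.
Proof.
by move=> x0; rewrite /oabs maxElt le_gtF // (le_trans _ x0) ?oz_oppr_le0.
Qed.

Lemma oabsN x : oabs (- x) = oabs x.
Proof. by rewrite /oabs opprK comparable_maxC // oz_comparable. Qed.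

Lemma oabs_cases x : 0 <= x /\ oabs x = x \/ 0 <= - x /\ oabs x = - x.
Proof.
have /orP[x0|x0] := oz_le_total 0 x; first by left; rewrite oabs_ge.
by right; rewrite -oabsN oabs_ge oz_oppr_ge0.
Qed.

Lemma oabs_mulrn x n : oabs (x *+ n) = oabs x *+ n.
Proof.
have h y : 0 <= y -> oabs (y *+ n) = y *+ n.
  by move=> y0; rewrite oabs_ge // -(mul0rn _ n) oz_leMn.
have [[x0 ->]|[x0 ->]] := oabs_cases x; first exact: h.
by rewrite -[LHS]oabsN -mulNrn h.
Qed.

Lemma oabs_id x : oabs (oabs x) = oabs x.
Proof. by rewrite oabs_ge // oabs_ge0. Qed.

Lemma le_oabs x : x <= oabs x.
Proof. by rewrite /oabs comparable_le_max ?oz_comparable // lexx. Qed.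

Lemma oabsD x y : oabs (x + y) <= oabs x + oabs y.
Proof.
have [[_ ->]|[_ ->]] := oabs_cases (x + y); first by rewrite oz_leD ?le_oabs.
by rewrite opprD -(oabsN x) -(oabsN y) oz_leD ?le_oabs.
Qed.

Lemma oz_torsion_free : torsion_free G.
Proof.
move=> n x n0 xn; apply/eqP; rewrite -oabs_eq0 eq_le oabs_ge0 andbT.
have : oabs x *+ n = 0 by rewrite -oabs_mulrn xn; apply/eqP; rewrite oabs_eq0.
by move=> <-; rewrite -[leLHS]mulr1n oz_leMnl ?oabs_ge0.
Qed.

Lemma arch_equiv_mulrn x n : (0 < n)%N -> arch_equiv (x *+ n) x.
Proof.
move=> n0; apply/asboolP; exists n; rewrite oabs_mulrn; split=> //.
by rewrite -mulrnA -[leLHS]mulr1n oz_leMnl ?oabs_ge0 // muln_gt0 n0.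
Qed.

Lemma arch_equiv_lt x y : arch_equiv x y -> ~~ arch_lt x y.
Proof.
move=> xy; apply/negP => /(arch_lt_equivl xy).
by rewrite (negbTE (arch_lt_irr _)).
Qed.

Lemma arch_lt0 u : u != 0 -> arch_lt 0 u.
Proof.
rewrite -oabs_eq0 => u0; apply/asboolP => n.
by rewrite (eqP (_ : oabs 0 == 0)) ?oabs_eq0 // mul0rn lt_neqAle eq_sym u0 oabs_ge0.
Qed.

Lemma arch_ltN x y : arch_lt (- x) y = arch_lt x y.
Proof. by rewrite /arch_lt oabsN. Qed.

Lemma arch_ltD x y u : arch_lt x u -> arch_lt y u -> arch_lt (x + y) u.
Proof.
wlog xy : x y / oabs x <= oabs y => [hw|] xu yu.
  have /orP[xy|xy] := oz_le_total (oabs x) (oabs y); first exact: hw.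
  by rewrite addrC; apply: hw.
move/asboolP: yu => yu; apply/asboolP => n; apply: le_lt_trans (yu (n + n)%N).
apply: le_trans (oz_leMn n (oabsD x y)) _.
by rewrite mulrnDl mulrnDr oz_leD ?oz_leMn.
Qed.

Lemma arch_lt_zmod_closed u : u != 0 -> zmod_closed [pred x : G | arch_lt x u].
Proof.
move=> u0; split=> [|x y]; rewrite !inE; first exact: arch_lt0.
by move=> xu yu; apply: arch_ltD; rewrite ?arch_ltN.
Qed.

Lemma arch_lt_division_closed u : division_closed [pred x : G | arch_lt x u].
Proof.
move=> n x n0; rewrite !inE => /asboolP h; apply/asboolP => k.
apply: le_lt_trans (h k); rewrite oabs_mulrn -mulrnA oz_leMnl ?oabs_ge0 //.
by rewrite leq_pmull.
Qed.

Lemma nat_valE x (c : rank G) :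
  nat_val x = Some c <-> x != 0 /\ arch_equiv x (val (repr c)).
Proof.
rewrite /nat_val; case: insubP => [v x0 <-|x0] /=; last first.
  by split=> // -[h]; rewrite h in x0.
have -> : (Some (arch_class v) = Some c) <-> arch_class v == c.
  by split=> [[->]//|/eqP->].
rewrite -{1}[c]arch_class_repr arch_class_eq; split=> [h|[_ h]] //.
by split; [exact: valP v|exact: h].
Qed.

(** Take a complement [A] of the subgroup [H] of elements negligible against [u], and keep its
    elements bounded by a multiple of [u]; the nonzero ones are all equivalent to [u]. *)
Lemma archimedean_component_exists (c : rank G) : divisible G ->
  exists B : {pred G}, archimedean_component c B.
Proof.
move=> divG; set u := val (repr c); have u0 : u != 0 := valP (repr c).
pose H : {pred G} := [pred x : G | arch_lt x u].
have cH : zmod_closed H := arch_lt_zmod_closed u0.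
have [A [[cA _] AH A_all]] := qcomplement_exists divG oz_torsion_free cH
  (@arch_lt_division_closed u).
have [A0 AB] := cA; have [H0 HB] := cH.
pose D (x : G) := exists n, oabs x <= oabs u *+ n.
have DN x : D (- x) -> D x by rewrite /D oabsN.
have DD x y : D x -> D y -> D (x + y).
  move=> [n hn] [m hm]; exists (n + m)%N.
  by apply: le_trans (oabsD _ _) _; rewrite mulrnDr oz_leD.
have Dequiv x : arch_equiv x u -> D x by move=> /asboolP[n [_ h]]; exists n.
have Dlt x : arch_lt x u -> D x.
  by move=> /asboolP/(_ 1%N)/ltW h; exists 1%N; rewrite mulr1n in h *.
pose B : {pred G} := fun x => (x \in A) && `[< D x >].
have BP x : reflect (x \in A /\ D x) (x \in B).
  by apply: (iffP andP) => -[? /asboolP].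
have cB : zmod_closed B.
  split=> [|x y /BP[xA xD] /BP[yA yD]]; apply/BP; split=> //.
  - exact/Dlt/arch_lt0.
  - exact: AB.
  - by apply: (DD) => //; apply: DN; rewrite opprK.
have B_equiv x : x \in B -> x != 0 -> arch_equiv x u.
  move=> /BP[xA [n xu]] x0; have /or3P[h|//|/asboolP/(_ n)] := arch_lt_total x u.
    by case/eqP: x0; apply: AH.
  by rewrite oz_ltNge xu.
(* The [A]-part [b] of [u] differs from [u] by a negligible element, so it is a nonzero element of
   [B]. *)
have [b bA [h' hH' uE]] := A_all u.
have bB : b \in B.
  apply/BP; split=> //; have -> : b = u - h' by rewrite uE addrK.
  apply: (DD); first by apply: Dequiv; exact: arch_equiv_refl.
  by apply: Dlt; rewrite arch_ltN.
have b0 : b != 0.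
  apply/eqP => b0; have := arch_lt_irr u.
  by rewrite {1}uE b0 add0r (hH' : arch_lt h' u).
exists B; split.
- split=> // x y xB yB x0 y0; apply: arch_equiv_trans (B_equiv _ xB x0) _.
  by rewrite arch_equiv_sym B_equiv.
- by exists b => //; apply/nat_valE; split=> //; apply: B_equiv.
(* Maximality: write [y = a + h]. Then [a] lies in [B], so [h] lies in [B']; if nonzero, it would be
   equivalent to [u] yet negligible against it. *)
move=> B' [cB' aB'] BB' y yB'; have [a aA [h hH yE]] := A_all y.
have [C0 CB] := cB'.
have B'_equiv z : z \in B' -> z != 0 -> arch_equiv z u.
  move=> zB' z0; apply: arch_equiv_trans (B_equiv _ bB b0).
  by apply: aB' => //; exact: BB'.
have [y0|y0] := eqVneq y 0; first by rewrite y0; case: cB.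
have aD : a \in B.
  apply/BP; split=> //; have -> : a = y - h by rewrite yE addrK.
  by apply: (DD); [apply/Dequiv/B'_equiv|apply/Dlt; rewrite arch_ltN].
have hB' : h \in B'.
  have -> : h = y - a by rewrite yE addrAC subrr add0r.
  by apply: (CB) => //; apply: BB'.
suff h0 : h = 0 by rewrite yE h0 addr0.
apply/eqP/negPn/negP => /(B'_equiv _ hB') /arch_equiv_lt.
by rewrite (hH : arch_lt h u).
Qed.

End ArchimedeanClasses.

(** * Transfer of Archimedean comparison along quotient maps *)

Section OrderQuotients.
Variables (V G : orderedZmodType) (H : {pred V}) (f : V -> G).
Hypothesis qf : order_quotient H f.

Lemma order_quotient_le x y : x <= y -> f x <= f y.
Proof.
have [fD f_ge0 _ _] := qf; rewrite -oz_subr_ge0 => /f_ge0.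
by rewrite fD (order_quotientN qf) oz_subr_ge0.
Qed.

Lemma order_quotient_mulrn x n : f (x *+ n) = f x *+ n.
Proof.
have [fD _ _ _] := qf; elim: n => [|n IHn]; first exact: order_quotient0 qf.
by rewrite !mulrS fD IHn.
Qed.

Lemma order_quotient_oabs x : f (oabs x) = oabs (f x).
Proof.
have [_ f_ge0 _ _] := qf.
have [[x0 ->]|[x0 ->]] := oabs_cases x; first by rewrite oabs_ge ?f_ge0.
by rewrite -oabsN -(order_quotientN qf) oabs_ge ?f_ge0.
Qed.

Lemma order_quotient_divisible : divisible V -> divisible G.
Proof.
move=> divV n g n0; have [_ _ _ f_surj] := qf; have [x <-] := f_surj g.
by have [y <-] := divV n x n0; exists (f y); rewrite order_quotient_mulrn.
Qed.

Lemma order_quotient_kernel : zmod_closed H.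
Proof.
have [fD _ f_eq0 _] := qf; split=> [|x y /f_eq0 x0 /f_eq0 y0]; apply/f_eq0.
  exact: order_quotient0 qf.
by rewrite fD (order_quotientN qf) x0 y0 subr0.
Qed.

Lemma order_quotient_kernel_division_closed : division_closed H.
Proof.
have [_ _ f_eq0 _] := qf; move=> n x n0 /f_eq0 xn; apply/f_eq0.
by apply: (oz_torsion_free n0); rewrite -order_quotient_mulrn.
Qed.

Lemma order_quotient_arch_lt x y :
  y \notin H -> arch_lt (f x) (f y) = arch_lt x y.
Proof.
move=> yH; have [_ f_ge0 f_eq0 _] := qf.
apply/asboolP/asboolP => h n; rewrite -?order_quotient_oabs.
  apply: (order_quotient_lt qf); rewrite order_quotient_mulrn !order_quotient_oabs.
  exact: h.
rewrite oz_ltNge; apply/negP => le_n.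
(* A strict inequality becomes weak under [f]. Using [n.+1] against the assumed bound for [n] forces
   [f (oabs x) <= 0], and then [y] into the kernel. *)
have := order_quotient_le (ltW (h n.+1)).
rewrite order_quotient_mulrn mulrS => le_n1.
have x0 : f (oabs x) <= 0.
  have := le_trans le_n1 le_n => /(oz_leD2l (- (f (oabs x) *+ n))).
  by rewrite addrCA addNr addr0.
case/negP: yH; apply/f_eq0/eqP; rewrite -oabs_eq0 eq_le oabs_ge0 andbT.
rewrite -order_quotient_oabs (le_trans le_n) // -(mul0rn _ n).
exact: oz_leMn.
Qed.

End OrderQuotients.

(** * Left exponentiation and the value group *)

Section Divisibility.
Variable K : rcfType.

Lemma additive_group_divisible : divisible (additive_group K).
Proof.
move=> n x n0; exists ((x : K) / n%:R : K).
have nK0 : n%:R != 0 :> K by rewrite pnatr_eq0 -lt0n.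
rewrite -[RHS](divfK nK0 (x : K)) [RHS]mulr_natr //.
Qed.

Lemma positive_group_divisible : divisible (positive_group K).
Proof.
move=> n x n0; have x0 := valP x.
pose p : {poly K} := 'X^n - (val x)%:P.
have pE y : p.[y] = y ^+ n - val x by rewrite !hornerE.
(* The intermediate value theorem gives an [n]-th root; the upper end works because
   [(1 + x) ^ n >= 1 + x > x]. *)
have [||y /andP[y0 _] /rootP] := @poly_ivt K p 0 (1 + val x).
- by rewrite addr_ge0 ?ler01 ?ltW.
- rewrite !pE expr0n eqn0Ngt n0 /= sub0r oppr_le0 ltW //= subr_ge0.
  apply: le_trans (_ : (1 + val x) ^+ 1 <= _); first by rewrite expr1 lerDr.
  by rewrite ler_eXn2l // ltrDl.
rewrite pE => /eqP; rewrite subr_eq0 => /eqP yn.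
have y_gt0 : 0 < y.
  rewrite lt_neqAle y0 andbT eq_sym; apply: contraTneq x0 => y00.
  by rewrite -yn y00 expr0n eqn0Ngt n0 ltxx.
pose z : positive_group K := exist _ y y_gt0.
exists z; apply/val_inj; rewrite -yn.
by elim: n {n0 p pE yn} => // n IHn; rewrite mulrS exprS -IHn.
Qed.

End Divisibility.

(** * The residue map and the residue field as an Archimedean group *)

Section Residue.
Variable K : rcfType.
Implicit Types s t : K.

(** The residue map made total on [K], with value 0 outside the valuation ring. *)
Definition res t : residue_field K := residue (insubd (0 : val_ring_type K) t).

Lemma val_res t : t \in @val_ring K -> val (insubd (0 : val_ring_type K) t) = t.
Proof. by move=> tR; rewrite val_insubd tR. Qed.

Lemma res_eq s t : s \in @val_ring K -> t \in @val_ring K ->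
  (res s == res t) = (s - t \in @val_ideal K).
Proof. by move=> sR tR; rewrite /res residue_eq !val_res. Qed.

Lemma resD s t : s \in @val_ring K -> t \in @val_ring K ->
  res (s + t) = res s + res t.
Proof.
move=> sR tR; rewrite /res -residueD; congr residue; apply/val_inj.
pose i x := insubd (0 : val_ring_type K) x.
by rewrite -/(i t) -/(i s) -[RHS]/(val (i s) + val (i t)) !val_res ?rpredD.
Qed.

Lemma res0 : res 0 = 0.
Proof.
by rewrite /res -residue0; congr residue; apply/val_inj; rewrite val_res ?rpred0.
Qed.

Lemma res_eq0 t : t \in @val_ring K -> (res t == 0) = (t \in @val_ideal K).
Proof. by move=> tR; rewrite -res0 res_eq ?rpred0 // subr0. Qed.

Lemma res_ge0 t : t \in @val_ring K -> 0 <= t -> 0 <= res t.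
Proof.
move=> tR t0; rewrite leNgt -residue0 /res residue_ltE val_res // negb_and.
by rewrite -leNgt t0 orbT.
Qed.

Lemma res_surj (y : residue_field K) : exists2 t, t \in @val_ring K & res t = y.
Proof.
exists (val (repr y)); first exact: valP.
rewrite -[RHS]residue_repr; congr residue; apply/val_inj.
by rewrite val_res //; apply: valP.
Qed.

Lemma resN t : t \in @val_ring K -> res (- t) = - res t.
Proof.
by move=> tR; apply: (addrI (res t)); rewrite -resD ?rpredN // !subrr res0.
Qed.

Lemma res_mulrn t n : t \in @val_ring K -> res (t *+ n) = res t *+ n.
Proof.
move=> tR; elim: n => [|n IHn]; first exact: res0.
by rewrite !mulrS resD ?rpredMn // IHn.
Qed.

Lemma res_lt s t : s \in @val_ring K -> t \in @val_ring K -> res s < res t -> s < t.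
Proof.
move=> sR tR; rewrite !ltNge; apply: contra => ts.
rewrite -oz_subr_ge0 -resN // -resD ?rpredN //.
by apply: res_ge0; rewrite ?rpredB // subr_ge0.
Qed.

(** A positive lift [s] of a nonzero class is not infinitesimal, so [1 <= s *+ k]; any lift is at
    most some [m], hence at most [s *+ (k * m)]. *)
Lemma residue_archimedean : archimedean_on (predT : {pred residue_field K}).
Proof.
have not_lt (x y : residue_field K) : x != 0 -> ~~ arch_lt x y.
  move=> x0; apply/negP => /asboolP xy.
  have [s sR sx] := res_surj (oabs x); have [t tR ty] := res_surj (oabs y).
  have st n : s *+ n < t.
    by apply: res_lt; rewrite ?rpredMn // res_mulrn // sx ty.
  have s0 : 0 <= s.
    apply/ltW/res_lt; rewrite ?rpred0 // res0 sx lt_neqAle eq_sym oabs_eq0 x0.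
    exact: oabs_ge0.
  have : s \notin @val_ideal K by rewrite -res_eq0 // sx oabs_eq0.
  move=> /val_idealP/existsNP[k /negP]; rewrite -leNgt ger0_norm // => sk.
  have /val_ringP[m /(le_trans (ler_norm t)) tm] := tR.
  have := lt_le_trans (st (k * m)%N) tm; apply/negP; rewrite -leNgt mulrnA.
  by rewrite lerMn2r sk orbT.
move=> x y _ _ x0 y0.
by have := arch_lt_total x y; rewrite !(negbTE (not_lt _ _ _)) ?orbF.
Qed.

End Residue.

(** * Rank and Archimedean components of the value group *)

Section ExponentialGroup.
Variable K : rcfType.
Local Notation G := (value_group K).
Variable lam : additive_group K -> G.
Hypothesis qlam : @order_quotient (additive_group K) G (@val_ring K) lam.

Lemma lam_neq0 (x : K) : lam x != 0 -> x \notin @val_ring K.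
Proof. by have [_ _ lam_eq0 _] := qlam; apply: contra => /lam_eq0 ->. Qed.

Lemma arch_lt1 (x : K) :
  arch_lt (1 : additive_group K) (x : additive_group K) = (x \notin @val_ring K).
Proof.
apply/asboolP/idP => [h|].
  by apply/val_ringP => -[n]; have := h n; rewrite !oabsE normr1 ltNge => /negP.
move=> /val_ringP/forallNP h n; have /negP := h n.
by rewrite !oabsE normr1 -ltNge.
Qed.

(** [G] is itself the rank of [K], so the class of [g] can be sent to the class of a lift [rho g].
    Lifts of nonzero elements are infinite, and infinite elements are those of negative value. *)
Lemma value_group_rank : exists f : rank G -> G,
  {mono f : c d / c <= d} /\ forall x : G, (exists c, f c = x) <-> x < 0.
Proof.
have [_ _ lam_eq0 lam_surj] := qlam; have [rho rhoK] := @choice _ _ _ lam_surj.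
have rhoN (u : nonzero G) : rho (val u) \notin @val_ring K.
  by apply: lam_neq0; rewrite rhoK; exact: (valP u).
have rho_arch g h : h != 0 -> arch_lt (rho g) (rho h) = arch_lt g h.
  move=> h0; have rhoN' : rho h \notin @val_ring K by apply: lam_neq0; rewrite rhoK.
  by have := order_quotient_arch_lt qlam (rho g) rhoN'; rewrite !rhoK.
have rho0 (u : nonzero G) : rho (val u) != 0.
  by apply: contraNneq (rhoN u) => ->; exact: rpred0.
pose nzrho (u : nonzero G) : nonzero (additive_group K) :=
  exist (fun y : additive_group K => y != 0) (rho (val u)) (rho0 u).
have rho_lt u v : (arch_class (nzrho u) < arch_class (nzrho v)) =
    (arch_class u < arch_class v).
  by rewrite !rank_ltE; apply: rho_arch; exact: (valP u).
exists (fun c => arch_class (nzrho (repr c)) : G); split=> [c d|x].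
  rewrite [in RHS]leNgt -[in RHS](arch_class_repr c) -[in RHS](arch_class_repr d).
  by rewrite -rho_lt -leNgt.
have zeroE : (0 : G) = arch_class (nz_one K) by [].
split=> [[c <-]|]; first by rewrite zeroE rank_ltE arch_lt1 rhoN.
rewrite -[x]val_class_repr; set r := repr x; rewrite zeroE rank_ltE arch_lt1 => rN.
have lr0 : lam (val r) != 0 by apply: contra rN => /eqP/lam_eq0.
(* The class of [lam r] is the preimage: [r] and the chosen lift are both outside the kernel, so
   their comparison can be made after [lam]. *)
pose u : nonzero G := exist (fun g : G => g != 0) (lam (val r)) lr0.
exists (arch_class u); apply/eqP; rewrite /val_class arch_class_eq /=.
have := arch_lt_total (rho (val (repr (arch_class u)))) (val r).
have := order_quotient_arch_lt qlam (rho (val (repr (arch_class u)))) rN.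
have := order_quotient_arch_lt qlam (val r) (rhoN (repr (arch_class u))).
rewrite !rhoK => <- <-.
have : arch_equiv (val (repr (arch_class u))) (lam (val r)).
  by rewrite -[lam _]/(val u) -arch_class_eq arch_class_repr.
move=> h; rewrite (negbTE (arch_equiv_lt h)).
by rewrite arch_equiv_sym in h; rewrite (negbTE (arch_equiv_lt h)) orbF.
Qed.

(** The hypothesis makes the subgroup generated by [B] and [x] Archimedean, so it adds nothing to
    the maximal [B]. *)
Lemma archimedean_component_adjoin (c : rank G) B (x : G) :
    archimedean_component c B ->
    (forall b (k : int), b \in B -> b + x *~ k != 0 ->
       arch_equiv (b + x *~ k) (val (repr c))) ->
  x \in B.
Proof.
move=> [[cB _] _ Bmax] hx; have [B0 BB] := cB.
pose inB' z := exists b, exists2 k : int, b \in B & z = b + x *~ k.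
pose B' : {pred G} := fun z => `[< inB' z >].
have B'P z : reflect (inB' z) (z \in B') by exact: asboolP.
apply: (Bmax B').
- split=> [|y z /B'P[b [k bB ->]] /B'P[b' [k' bB' ->]] y0 z0].
    split=> [|y z /B'P[b [k bB ->]] /B'P[b' [k' bB' ->]]]; apply/B'P.
      by exists 0, 0; rewrite ?mulr0z ?addr0.
    exists (b - b'), (k - k'); first exact: BB.
    by rewrite mulrzBr opprD addrACA.
  by apply: arch_equiv_trans (hx _ _ bB y0) _; rewrite arch_equiv_sym hx.
- by move=> b bB; apply/B'P; exists b, 0; rewrite ?mulr0z ?addr0.
- by apply/B'P; exists 0, 1; rewrite ?mulr1z ?add0r.
Qed.

(** The isomorphism sends [g] to the residue of [rho g / a], where [a] is the absolute value of a
    lift of [u]. Injectivity holds since nonzero elements of [B] are not negligible against [u];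
    surjectivity comes from maximality of [B]. *)
Lemma archimedean_component_isog (c : rank G) (B : {pred G}) :
  archimedean_component c B ->
  ordered_isog B (predT : {pred residue_field K}).
Proof.
move=> compB; have [[cB aB] [x0 x0B /nat_valE[x0N x0E]] _] := compB.
have [B0 BB] := cB.
have [lamD _ lam_eq0 lam_surj] := qlam; have [rho rhoK] := @choice _ _ _ lam_surj.
set u := val (repr c) in x0E.
have u0 : u != 0 := valP (repr c).
have B_equiv b : b \in B -> b != 0 -> arch_equiv b u.
  by move=> bB bN; apply: arch_equiv_trans (aB _ _ bB x0B bN x0N) x0E.
pose a : K := `|rho u : K|.
have lam_a : lam a = oabs u by rewrite /a -oabsE (order_quotient_oabs qlam) rhoK.
have aN : a \notin @val_ring K by apply: lam_neq0; rewrite lam_a oabs_eq0.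
have a0 : 0 < a.
  rewrite lt_neqAle normr_ge0 andbT eq_sym.
  by apply: contraNneq aN => ->; exact: rpred0.
have a_gt n : n%:R < a.
  rewrite ltNge; apply: contra aN => h; apply/val_ringP; exists n.
  by rewrite gtr0_norm.
have lt_u (g : G) : arch_lt g u = arch_lt (rho g) (a : additive_group K).
  rewrite -(order_quotient_arch_lt qlam (rho g) aN) rhoK lam_a.
  by rewrite /arch_lt oabs_id.
pose D (g : G) := exists n, oabs g <= oabs u *+ n.
have DD g g' : D g -> D g' -> D (g + g').
  move=> [n hn] [m hm]; exists (n + m)%N.
  by apply: le_trans (oabsD _ _) _; rewrite mulrnDr oz_leD.
have D_B b : b \in B -> D b.
  have [-> _|b0 /B_equiv/(_ b0)/asboolP[n [_ h]]] := eqVneq b 0; last by exists n.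
  by exists 0%N; rewrite mulr0n (eqP (_ : oabs 0 == 0)) ?oabs_eq0.
pose q (g : G) : K := (rho g : K) / a.
(* As [a] is infinite, a finite error becomes infinitesimal after division. So the choice of lifts,
   and the failure of [rho] to be additive, leave no trace in the residue. *)
have finV s : s \in @val_ring K -> s / a \in @val_ideal K.
  move=> /val_ringP[k sk]; apply/val_idealP => n.
  rewrite normrM normfV (gtr0_norm a0) -mulrnAl ltr_pdivrMr // mul1r.
  apply: le_lt_trans (a_gt (k * n)%N); rewrite mulrnA lerMn2r.
  by rewrite sk orbT.
have idealW s : s \in @val_ideal K -> s \in @val_ring K.
  move=> /val_idealP/(_ 1%N)/ltW h; apply/val_ringP; exists 1%N.
  by rewrite mulr1n in h.
have qD g : D g -> q g \in @val_ring K.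
  move=> [n gn]; have [fin|inf] := boolP (rho g \in @val_ring K).
    exact/idealW/finV.
  have : ~~ arch_lt (a : additive_group K) (rho g).
    rewrite -(order_quotient_arch_lt qlam a inf) rhoK lam_a.
    by apply/asboolPn => /(_ n); rewrite oabs_id oz_ltNge gn.
  move=> /arch_ltNge[m]; rewrite !oabsE (gtr0_norm a0) => h.
  apply/val_ringP; exists m; rewrite normrM normfV (gtr0_norm a0).
  by rewrite ler_pdivrMr // mulr_natl.
have hD g g' : D g -> D g' -> res (q (g + g')) = res (q g) + res (q g').
  move=> Dg Dg'; rewrite -resD ?qD //; apply/eqP.
  rewrite res_eq ?rpredD ?qD //; last exact: DD.
  rewrite /q -mulrDl -mulrBl; apply: finV.
  have : lam (rho (g + g') - (rho g + rho g')) = 0.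
    by rewrite lamD (order_quotientN qlam) lamD !rhoK subrr.
  by move=> /lam_eq0.
have h_eq0 g : D g -> (res (q g) == 0) = arch_lt g u.
  move=> Dg; rewrite res_eq0 ?qD // lt_u.
  apply/val_idealP/asboolP => h n; have := h n; rewrite !oabsE (gtr0_norm a0);
    by rewrite /q normrM normfV (gtr0_norm a0) -mulrnAl ltr_pdivrMr // mul1r.
have h_eq0B b : b \in B -> res (q b) = 0 -> b = 0.
  move=> bB /eqP; rewrite (h_eq0 _ (D_B _ bB)); have [//|b0] := eqVneq b 0.
  by rewrite (negbTE (arch_equiv_lt (B_equiv _ bB b0))).
have h_ge0 g : D g -> 0 < g -> 0 <= res (q g).
  move=> Dg g0; apply: res_ge0; first exact: qD.
  rewrite divr_ge0 // ?ltW //.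
  by apply: (order_quotient_lt qlam); rewrite (order_quotient0 qlam) rhoK.
have D0 : D 0 by exact: D_B.
have h0 : res (q 0) = 0 by apply: (addrI (res (q 0))); rewrite -hD // !addr0.
have hN g : D g -> res (q (- g)) = - res (q g).
  move=> Dg; have DNg : D (- g) by case: Dg => n gn; exists n; rewrite oabsN.
  by apply: (addrI (res (q g))); rewrite -hD // !subrr.
have Dmulrz g (m : int) : D g -> D (g *~ m).
  move=> [n gn]; exists (n * `|m|)%N; case: m => m /=.
    by rewrite -pmulrn oabs_mulrn mulrnA oz_leMn.
  by rewrite NegzE mulrNz oabsN -pmulrn oabs_mulrn mulrnA oz_leMn.
have h_mulrz g (m : int) : D g -> res (q (g *~ m)) = res (q g) *~ m.
  move=> Dg; have h_mulrn n : res (q (g *+ n)) = res (q g) *+ n.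
    elim: n => [|n IHn]; first exact: h0.
    by rewrite !mulrS hD ?IHn // pmulrn; apply: Dmulrz.
  case: m => n; first by rewrite -!pmulrn.
  by rewrite NegzE !mulrNz -!pmulrn hN ?h_mulrn // pmulrn; apply: Dmulrz.
(* If [x *+ n] is in [B], then for each nonzero [z = b + x *~ k] the multiple [z *+ n] is in [B], so
   [z] has class [c] and [x] can be adjoined. *)
have B_div : division_closed B.
  move=> n x n0 xnB; apply: (archimedean_component_adjoin compB) => b k bB z0.
  set z := b + x *~ k in z0 *.
  have znB : z *+ n \in B.
    have -> : z *+ n = b *+ n + (x *+ n) *~ k.
      by rewrite mulrnDl !pmulrn -!mulrzA mulrC.
    apply: zmod_closedD => //; first exact: zmod_closed_mulrn.
    exact: zmod_closed_mulrz.
  have zn0 : z *+ n != 0 by apply: contra_neq z0; apply: oz_torsion_free.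
  apply: arch_equiv_trans (B_equiv _ znB zn0).
  by rewrite arch_equiv_sym arch_equiv_mulrn.
exists (fun g => res (q g)); split=> //.
- by move=> g g' gB gB'; apply: hD; apply: D_B.
- apply: oz_additive_mono => // [g g' gB gB'|g gB g0].
    by apply: hD; apply: D_B.
  rewrite lt_neqAle (h_ge0 _ (D_B _ gB) g0) andbT eq_sym.
  apply/eqP => /(h_eq0B _ gB) g00.
  by rewrite g00 ltxx in g0.
move=> y _; have [t tR ty] := res_surj y.
(* This [g] has residue [y] but may lie outside [B]. *)
pose g : G := lam (t * a).
have Dg : D g.
  have /val_ringP[n tn] := tR; exists n.
  rewrite -lam_a -(order_quotient_mulrn qlam) -(order_quotient_oabs qlam).
  apply: (order_quotient_le qlam); rewrite oabsE normrM (gtr0_norm a0).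
  have -> : (a : additive_group K) *+ n = n%:R * a by rewrite mulr_natl.
  by rewrite (ler_pM2r a0).
have hg : res (q g) = y.
  apply/eqP; rewrite -ty res_eq ?qD //.
  have -> : q g - t = (rho g - t * a) / a by rewrite /q mulrBl mulfK ?gt_eqF.
  apply: finV; have : lam (rho g - t * a) = 0.
    by rewrite lamD (order_quotientN qlam) rhoK subrr.
  by move=> /lam_eq0.
(* If some [b + g *~ k] with [k != 0] has residue 0, then [x = - b / k] lies in [B] and has the same
   residue as [g]. Otherwise every nonzero [b + g *~ k] has class [c], and [g] itself lies in
   [B]. *)
have [[b [k [bB k0 bk]]]|indep] := pselect (exists b, exists k : int,
    [/\ b \in B, k != 0 & res (q (b + g *~ k)) = 0]).
  have [x xk] := divisible_mulrz (- b)
    (order_quotient_divisible qlam (@additive_group_divisible K)) k0.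
  have xB : x \in B.
    by apply: (division_closed_mulrz cB B_div k0); rewrite xk -sub0r; apply: (BB).
  exists x => //; apply/eqP; rewrite -subr_eq0; apply/eqP.
  apply: (torsion_free_mulrz (@oz_torsion_free _) k0).
  rewrite mulrzBl -(h_mulrz x k (D_B _ xB)) xk (hN _ (D_B _ bB)) -hg.
  rewrite -(h_mulrz g k Dg) -opprD.
  by rewrite -(hD _ _ (D_B _ bB) (Dmulrz g k Dg)) bk oppr0.
exists g => //; apply: (archimedean_component_adjoin compB) => b k bB z0.
have [k0|k0] := eqVneq k 0.
  by move: z0; rewrite k0 mulr0z addr0; apply: B_equiv.
have Dz : D (b + g *~ k) by apply: DD; [apply: D_B|apply: Dmulrz].
have /or3P[zu|//|] := arch_lt_total (b + g *~ k) u.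
  by case: indep; exists b, k; split=> //; apply/eqP; rewrite h_eq0.
by case: Dz => n zn /asboolP h; have := h n; rewrite oz_ltNge zn.
Qed.

End ExponentialGroup.

Theorem theorem3 (K : rcfType)
    (K_nonarch : ~ Num.archimedean_axiom K)
    (K_ipa : exists Z : subringClosed K,
               integer_part Z /\ models_PA (nneg_cone Z)) :
  left_exponentiation K /\
  exponential_group (value_group K) (residue_field K).
Proof.
have [Z [Z_int [_ Z_ind]]] := K_ipa.
have [lam qlam] := value_group_quotient Z_int Z_ind.
have qmu := minus_val_quotient K.
have divK := @additive_group_divisible K.
split.
  have [A cA] := qcomplement_exists divK (@oz_torsion_free _)
    (order_quotient_kernel qlam) (order_quotient_kernel_division_closed qlam).
  have [B cB] := qcomplement_exists (@positive_group_divisible K)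
    (@oz_torsion_free _) (order_quotient_kernel qmu)
    (order_quotient_kernel_division_closed qmu).
  by exists A, B; split=> //; apply: order_quotient_isog qlam qmu cA cB.
split; [exact: residue_archimedean|exact: value_group_rank qlam|] => c.
split=> [|B]; last exact: archimedean_component_isog qlam _ _.
exact/archimedean_component_exists/(order_quotient_divisible qlam).
Qed.
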